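(* Let $\alpha>0$ and let $\mu$ be a positive Borel measure on $\mathbb{C}$ satisfying condition (M). Then the Toeplitz operator $T_\mu$ is compact on $F^\infty_\alpha$ if and only if $\tilde{\mu}_1\in C_0(\mathbb{C})$.
   Context: $F^\infty_\alpha$ is the space of entire functions $f$ with $\|f\|_{\infty,\alpha}=\sup_{z}|f(z)|e^{-\alpha|z|^2/2}<\infty$. $K_z(w)=e^{\alpha\bar z w}$. $\mu$ satisfies condition (M) if $\int_{\mathbb{C}}|K_z(w)|^2e^{-\alpha|w|^2}\,d\mu(w)<\infty$ for all $z$. $T_\mu f(z)=\int_{\mathbb{C}}f(w)\overline{K_z(w)}e^{-\alpha|w|^2}\,d\mu(w)$. $\tilde{\mu}_1(z)=\frac{\alpha}{\pi}\int_{\mathbb{C}}e^{-\alpha|z-w|^2/2}\,d\mu(w)$. $C_0(\mathbb{C})$ is the space of continuous functions on $\mathbb{C}$ tending to $0$ at infinity. *)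

(* Defs.v *)
From HB Require Import structures.
From mathcomp Require Import all_boot all_order all_algebra.
From mathcomp Require Import all_classical all_reals all_analysis.
From mathcomp Require Import complex.
Set Implicit Arguments.
Unset Strict Implicit.
Unset Printing Implicit Defensive.
Import Order.TTheory GRing.Theory Num.Theory numFieldNormedType.Exports.
Local Open Scope classical_set_scope.
Local Open Scope ring_scope.
Local Open Scope complex_scope.

Section FockDefs.
Variable R : realType.

Definition cnorm2 (z : R[i]) : R := complex.Re z ^+ 2 + complex.Im z ^+ 2.
Definition cabs (z : R[i]) : R := Num.sqrt (cnorm2 z).

Definition cexp (u : R[i]) : R[i] :=
  (expR (complex.Re u) * cos (complex.Im u)) +i* (expR (complex.Re u) * sin (complex.Im u)).

(* the plane C = R^2 as the measurable space R * R (product of the Borel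
   sigma-algebras = Borel sigma-algebra of C); toC identifies it with R[i] *)
Definition toC (w : R * R) : R[i] := w.1 +i* w.2.

(* entire function: complex differentiable at every point (the scalar h in
   the difference quotient ranges over R[i]) *)
Definition entire (f : R[i] -> R[i]) : Prop :=
  forall z : R[i], derivable (f : R[i]^o -> R[i]^o) z 1.

Definition fock_norm (alpha : R) (f : R[i] -> R[i]) : \bar R :=
  ereal_sup [set (cabs (f z) * expR (- alpha * cnorm2 z / 2))%:E | z in [set: R[i]]].

Definition in_Finf (alpha : R) (f : R[i] -> R[i]) : Prop :=
  entire f /\ (fock_norm alpha f < +oo)%E.

Definition Kern (alpha : R) (z w : R[i]) : R[i] := cexp (alpha%:C * (z^* * w)).

Definition condM (alpha : R) (mu : {measure set (R * R)%type -> \bar R}) : Prop :=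
  forall z : R[i],
    (\int[mu]_(w in [set: R * R])
        (cnorm2 (Kern alpha z (toC w)) * expR (- alpha * cnorm2 (toC w)))%:E < +oo)%E.

Definition toep_integrand (alpha : R) (mu : {measure set (R * R)%type -> \bar R})
  (f : R[i] -> R[i]) (z : R[i]) (w : R * R) : R[i] :=
  f (toC w) * (Kern alpha z (toC w))^* * (expR (- alpha * cnorm2 (toC w)))%:C.

Definition toep_integrable (alpha : R) (mu : {measure set (R * R)%type -> \bar R})
  (f : R[i] -> R[i]) (z : R[i]) : Prop :=
  mu.-integrable [set: R * R] (fun w => (complex.Re (toep_integrand alpha mu f z w))%:E) /\
  mu.-integrable [set: R * R] (fun w => (complex.Im (toep_integrand alpha mu f z w))%:E).

Definition Toeplitz (alpha : R) (mu : {measure set (R * R)%type -> \bar R})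
  (f : R[i] -> R[i]) (z : R[i]) : R[i] :=
  (Rintegral mu [set: R * R] (fun w => complex.Re (toep_integrand alpha mu f z w)))
  +i* (Rintegral mu [set: R * R] (fun w => complex.Im (toep_integrand alpha mu f z w))).

Definition Toeplitz_compact (alpha : R) (mu : {measure set (R * R)%type -> \bar R}) : Prop :=
  (forall f, in_Finf alpha f -> forall z, toep_integrable alpha mu f z) /\
  (forall f, in_Finf alpha f -> in_Finf alpha (Toeplitz alpha mu f)) /\
  (forall (fs : nat -> R[i] -> R[i]) (M : R),
      (forall n, in_Finf alpha (fs n)) ->
      (forall n, (fock_norm alpha (fs n) <= M%:E)%E) ->
      exists (phi : nat -> nat) (g : R[i] -> R[i]),
        {homo phi : m n / (m < n)%N} /\ in_Finf alpha g /\
        ((fun k => fock_norm alpha (Toeplitz alpha mu (fs (phi k)) \- g)) @ \oo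
           --> (0 : \bar R)%E)).

Definition mu_tilde1 (alpha : R) (mu : {measure set (R * R)%type -> \bar R})
  (z : R[i]) : \bar R :=
  ((alpha / pi)%:E *
   \int[mu]_(w in [set: R * R]) (expR (- alpha * cnorm2 (z - toC w) / 2))%:E)%E.

Definition C0 (h : R[i] -> R) : Prop :=
  continuous (h : R[i]^o -> R) /\
  (forall e : R, 0 < e -> exists r : R, forall z : R[i], r < cabs z -> `|h z| < e).

Definition in_C0_ext (h : R[i] -> \bar R) : Prop :=
  (forall z, h z \is a fin_num) /\ C0 (fun z => fine (h z)).

End FockDefs.

(* Main.v *)
(* Write G_z(w) = exp(- alpha |z - w|^2 / 2), S(z) = int G_z dmu and
   H(z) = int G_z^2 dmu, so that S is mu_tilde1 up to a constant.

   If S tends to 0 at infinity, then |T f(z)| exp(- alpha |z|^2 / 2) is at most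
   2 ||f|| S(z).  Differentiation under the integral gives a second order Taylor
   estimate for T f that is uniform for f in a ball and z in a disc; it passes to
   limits along an ultrafilter, which replaces Montel's theorem (no Cauchy formula
   is needed), and near infinity S(z) is small.

   Conversely, let k_a be the normalized reproducing kernel at a.  Then
   |T k_a(a)| exp(- alpha |a|^2 / 2) >= H(a), whence compactness bounds H.  By the
   parallelogram law |T k_a(z)| is bounded by exp(- alpha |a - z|^2 / 4) times the
   value of H at (a + z) / 2, up to a factor depending on z.  Thus T k_a -> 0
   pointwise as a goes to infinity, and compactness forces H -> 0.  Finally
   G_z <= A G_z^2 + (1/8) (the sum of G over the four points z + 1, z - 1, z + i,
   z - i); as 4/8 < 1, boundedness and decay are inherited by S from H. *)
Require Import Defs.
From HB Require Import structures.
From mathcomp Require Import all_boot all_order all_algebra.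
From mathcomp Require Import all_classical all_reals all_analysis.
From mathcomp Require Import measurable_realfun complex ring lra.
Set Implicit Arguments.
Unset Strict Implicit.
Unset Printing Implicit Defensive.
Import Order.TTheory GRing.Theory Num.Theory numFieldNormedType.Exports.
Local Open Scope ring_scope.
Local Open Scope complex_scope.
Local Open Scope classical_set_scope.

(** * Modulus and exponential *)

Section ComplexModulus.
Context {R : realType}.
Implicit Types (x y : R) (z u h : R[i]).

Lemma cabsE z : cabs z = Normc.normc z.
Proof. by case: z. Qed.

Lemma normcE_cabs z : `|z| = (cabs z)%:C.
Proof. by rewrite normc_def. Qed.

Lemma cabs_ge0 z : 0 <= cabs z.
Proof. exact: sqrtr_ge0. Qed.

Lemma sqr_cabs z : cabs z ^+ 2 = cnorm2 z.
Proof. by rewrite sqr_sqrtr// addr_ge0 ?sqr_ge0. Qed.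

Lemma cabsM z u : cabs (z * u) = cabs z * cabs u.
Proof. by rewrite !cabsE Normc.normcM. Qed.

Lemma cabsD z u : cabs (z + u) <= cabs z + cabs u.
Proof. by rewrite !cabsE; exact: le_normcD. Qed.

Lemma cabsN z : cabs (- z) = cabs z.
Proof. by rewrite !cabsE; exact: normcN. Qed.

Lemma cabsB z u : cabs (z - u) <= cabs z + cabs u.
Proof. by rewrite (le_trans (cabsD _ _))// cabsN. Qed.

Lemma cabsC z u : cabs (z - u) = cabs (u - z).
Proof. by rewrite -cabsN opprB. Qed.

Lemma cabs_conj z : cabs (z^*) = cabs z.
Proof. by case: z => a b; rewrite /cabs /cnorm2 /= sqrrN. Qed.

Lemma cabs_real x : cabs x%:C = `|x|.
Proof. by rewrite /cabs /cnorm2 /= expr0n addr0 sqrtr_sqr. Qed.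

Lemma Re_le_cabs z : `|complex.Re z| <= cabs z.
Proof. by rewrite -sqrtr_sqr ler_wsqrtr// lerDl sqr_ge0. Qed.

Lemma Im_le_cabs z : `|complex.Im z| <= cabs z.
Proof. by rewrite -sqrtr_sqr ler_wsqrtr// lerDr sqr_ge0. Qed.

Lemma cabs_le_l1 z : cabs z <= `|complex.Re z| + `|complex.Im z|.
Proof.
rewrite -(ler_pXn2r (ltn0Sn 1)) ?nnegrE ?cabs_ge0 ?addr_ge0//.
rewrite sqr_cabs /cnorm2 sqrrD !real_normK ?num_real//.
by rewrite lerD2r lerDl mulrn_wge0// mulr_ge0.
Qed.

Lemma cabs_eq0 z : cabs z = 0 -> z = 0.
Proof. by rewrite cabsE; exact: Normc.eq0_normc. Qed.

Lemma cexpD z u : cexp (z + u) = cexp z * cexp u.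
Proof.
case: z u => a b [c d]; rewrite /cexp /=; apply/eqP; rewrite eq_complex /=.
by rewrite expRD cosD sinD; apply/andP; split; apply/eqP; ring.
Qed.

Lemma cabs_cexp z : cabs (cexp z) = expR (complex.Re z).
Proof.
rewrite /cabs /cnorm2 /= !exprMn -mulrDr cos2Dsin2 mulr1 sqrtr_sqr.
by rewrite ger0_norm// expR_ge0.
Qed.

Lemma conj_cexp z : (cexp z)^* = cexp (z^*).
Proof. by case: z => a b; rewrite /cexp /= cosN sinN mulrN. Qed.

Lemma norm_sin_le x : `|sin x| <= `|x|.
Proof.
wlog x0 : x / 0 <= x.
  move=> H; have [/H//|/ltW x0] := leP 0 x.
  by rewrite -normrN -sinN -(normrN x); apply: H; rewrite oppr_ge0.
have [c _] := @MVT_segment R sin cos 0 x x0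
  (fun y _ => is_derive_sin y) (continuous_subspaceT (@continuous_sin R)).
rewrite sin0 !subr0 => ->; rewrite normrM ler_piMl//.
by rewrite cos_max.
Qed.

(** The half-angle formula turns [cos x - 1] into [- 2 sin (x / 2) ^ 2]; the sharper constant 1/2 is
    given away. *)
Lemma norm_cosB1_le x : `|cos x - 1| <= x ^+ 2.
Proof.
have -> : cos x - 1 = - (sin (x / 2) ^+ 2 *+ 2).
  have e : x = (x / 2) *+ 2 by rewrite -mulr_natr; field.
  by rewrite {1}e cos_mulr2n cos2sin2; ring.
rewrite normrN normrMn normrX.
have : `|sin (x / 2)| ^+ 2 <= `|x / 2| ^+ 2 by rewrite lerXn2r ?nnegrE// norm_sin_le.
rewrite (real_normK (num_real (x / 2))) expr_div_n -mulr_natr => h.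
by have := sqr_ge0 x; lra.
Qed.

(** Two applications of the mean value theorem: [sin x - x = x (cos c - 1)] and
    [cos c - 1 = - c sin d] with [0 < c < x]. *)
Lemma norm_sinBid_le x : `|sin x - x| <= x ^+ 2.
Proof.
wlog x0 : x / 0 <= x.
  move=> H; have [/H//|/ltW x0] := leP 0 x.
  have := H (- x); rewrite oppr_ge0 sinN sqrrN -opprD normrN; exact.
have D y : y \in `]0, x[%R -> is_derive y 1 (sin \- id) (cos y - 1).
  by move=> _; apply: is_deriveB.
have Ct : continuous (sin \- id : R -> R).
  by move=> y; apply: cvgB; [exact: continuous_sin|exact: cvg_id].
have [c] := MVT_segment x0 D (continuous_subspaceT Ct).
rewrite in_itv/= => /andP[c0 cx]; rewrite sin0 !subr0 => ->.
rewrite normrM (ger0_norm x0) expr2 ler_wpM2r//.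
have [d _] := @MVT_segment R cos (fun y => - sin y) 0 c c0
  (fun y _ => is_derive_cos y) (continuous_subspaceT (@continuous_cos R)).
rewrite cos0 subr0 => ->; rewrite normrM normrN (ger0_norm c0).
by rewrite (le_trans _ cx)// ler_piMl// sin_max.
Qed.

(** Both signs follow from [1 + x <= expR x] and its value at [- x], that is
    [(1 - x) expR x <= 1]. *)
Lemma expRB1_le x : `|expR x - 1| <= `|x| * expR `|x|.
Proof.
have := expR_ge1Dx x; have := expR_ge1Dx (- x); rewrite expRN => h1 h2.
have e0 := expR_gt0 x.
have h3 : (1 - x) * expR x <= 1.
  by rewrite -ler_pdivlMr// div1r.
have [x0|x0] := leP 0 x.
  by rewrite ger0_norm ?(ger0_norm x0); nra.
rewrite ler0_norm; last by rewrite subr_le0 -expR0 ler_expR ltW.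
have : 1 <= expR (- x) by rewrite -expR0 ler_expR oppr_ge0 ltW.
by rewrite ltr0_norm//; nra.
Qed.

Lemma expRB1Bid_le x : `|expR x - 1 - x| <= x ^+ 2 * expR `|x|.
Proof.
have h2 := expR_ge1Dx x.
rewrite ger0_norm; last lra.
(* This intermediate bound is a rearrangement of [(1 - x) expR x <= 1]; it reduces second order to
   first order. *)
apply: (@le_trans _ _ (x * (expR x - 1))).
  have := expR_ge1Dx (- x); rewrite expRN => h1.
  have h3 : (1 - x) * expR x <= 1 by rewrite -ler_pdivlMr ?expR_gt0// div1r.
  nra.
rewrite (le_trans (ler_norm _))// normrM expr2 -[X in _ <= X * _]ger0_norm.
  by rewrite normrM -mulrA ler_wpM2l// expRB1_le.
by rewrite -expr2 sqr_ge0.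
Qed.

Lemma norm_mul_le_sqrD x y : `|x| * `|y| <= x ^+ 2 + y ^+ 2.
Proof.
rewrite -(real_normK (num_real x)) -(real_normK (num_real y)).
by have := normr_ge0 x; have := normr_ge0 y; nra.
Qed.

(** Real and imaginary parts split into one-variable remainders of [expR], [cos] and [sin], each at
    most a multiple of [expR (cabs h)]. With squares X and Y of the two coordinates of h they add up
    to 2X + 3Y, so 4 is ample. *)
Lemma cexp_remainder_le h :
  cabs (cexp h - 1 - h) <= 4 * cabs h ^+ 2 * expR (cabs h).
Proof.
rewrite sqr_cabs.
have hx := Re_le_cabs h; have hy := Im_le_cabs h.
apply: (le_trans (cabs_le_l1 _)).
have -> : complex.Re (cexp h - 1 - h) = (expR (complex.Re h) - 1 - complex.Re h)
   + expR (complex.Re h) * (cos (complex.Im h) - 1) by case: h {hx hy} => x y /=; ring.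
have -> : complex.Im (cexp h - 1 - h) = (expR (complex.Re h) - 1) * complex.Im h
   + expR (complex.Re h) * (sin (complex.Im h) - complex.Im h).
  by case: h {hx hy} => x y /=; ring.
rewrite /cnorm2; set x := complex.Re h; set y := complex.Im h.
rewrite -/x -/y in hx hy.
have E1 : expR x <= expR (cabs h).
  by rewrite ler_expR (le_trans _ hx)// ler_norm.
have E2 : expR `|x| <= expR (cabs h) by rewrite ler_expR.
have e1 : `|expR x - 1 - x| <= x ^+ 2 * expR (cabs h).
  by apply: (le_trans (expRB1Bid_le x)); rewrite ler_wpM2l// sqr_ge0.
have e2 : `|expR x * (cos y - 1)| <= y ^+ 2 * expR (cabs h).
  rewrite normrM (ger0_norm (expR_ge0 x)) mulrC.
  by rewrite ler_pM ?expR_ge0 ?norm_cosB1_le.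
have e3 : `|expR x * (sin y - y)| <= y ^+ 2 * expR (cabs h).
  rewrite normrM (ger0_norm (expR_ge0 x)) mulrC.
  by rewrite ler_pM ?expR_ge0 ?norm_sinBid_le.
have e4 : `|(expR x - 1) * y| <= (x ^+ 2 + y ^+ 2) * expR (cabs h).
  rewrite normrM (le_trans (ler_wpM2r _ (expRB1_le x)))// mulrAC.
  apply: ler_pM; rewrite ?mulr_ge0 ?expR_ge0//.
  exact: norm_mul_le_sqrD.
rewrite (le_trans (lerD (ler_normD _ _) (ler_normD _ _)))//.
move: e1 e2 e3 e4 (expR_ge0 (cabs h)) (sqr_ge0 x) (sqr_ge0 y).
clear; set E := expR (cabs h); move: (x ^+ 2) (y ^+ 2) => X Y.
move=> e1 e2 e3 e4 E0 X0 Y0.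
rewrite (le_trans (lerD (lerD e1 e2) (lerD e4 e3)))//.
by have := mulr_ge0 X0 E0; have := mulr_ge0 Y0 E0; lra.
Qed.

Lemma cexp_taylor_le u h :
  cabs (cexp (u + h) - cexp u - h * cexp u) <=
  4 * cabs h ^+ 2 * expR (complex.Re u + cabs h).
Proof.
have -> : cexp (u + h) - cexp u - h * cexp u = cexp u * (cexp h - 1 - h).
  by rewrite cexpD; ring.
rewrite cabsM cabs_cexp expRD mulrCA; apply: ler_wpM2l; first exact: expR_ge0.
exact: cexp_remainder_le.
Qed.

End ComplexModulus.

(** * Topology and measurability of the plane *)

Section ComplexTopology.
Context {R : realType}.
Implicit Types (z u h d : R[i]) (f : R[i] -> R[i]).

Lemma cabs_lt_norm u (e : R) : (`|u| < e%:C) = (cabs u < e).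
Proof. by rewrite normcE_cabs ltcR. Qed.

Lemma complex_gt0 (e : R[i]) : 0 < e -> exists2 r : R, 0 < r & e = r%:C.
Proof.
case: e => a b; rewrite ltcE /= => /andP[/eqP-> a0].
by exists a.
Qed.

(** The norm of [R[i]] takes complex values; a positive complex number is real, so neighbourhoods
    can be described by real radii and [cabs]. *)
Lemma nbhs_cabsP z (P : set (R[i]^o)) :
  nbhs (z : R[i]^o) P <->
  exists2 r : R, 0 < r & forall u, cabs (u - z) < r -> P u.
Proof.
split=> [/nbhs_normP[e /= e0 eP]|[r r0 rP]].
  have [r r0 er] := complex_gt0 e0.
  exists r => // u ur; apply: eP => /=.
  by rewrite /ball_ /= er cabs_lt_norm cabsC.
apply/(@nbhs_normP _ (R[i]^o)); exists r%:C; first by rewrite /= ltcR.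
by move=> u /=; rewrite cabs_lt_norm cabsC; exact: rP.
Qed.

(** The difference quotient is within [C |h|] of [d]. Every entire function constructed below is
    shown to be differentiable through this criterion. *)
Lemma derivable_of_quadratic_remainder f z d (C : R) :
  (forall h, cabs h <= 1 -> cabs (f (z + h) - f z - h * d) <= C * cabs h ^+ 2) ->
  derivable (f : R[i]^o -> R[i]^o) z 1.
Proof.
move=> fC; apply/cvg_ex; exists d; apply/cvgrPdist_le => _ /complex_gt0[e e0 ->].
(* [C] carries no sign condition; this is a positive substitute to divide by. *)
have C1 : 0 < `|C| + 1 by rewrite ltr_wpDl.
have m0 : 0 < Num.min 1 (e / (`|C| + 1)).
  by rewrite lt_min ltr01 divr_gt0.
apply/nbhs_cabsP; exists (Num.min 1 (e / (`|C| + 1))) => // h.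
rewrite subr0 lt_min => /andP[h1 he] h0; rewrite /= normcE_cabs lecR.
have h00 : 0 < cabs h.
  by rewrite lt_neqAle cabs_ge0 eq_sym andbT; apply: contra h0 => /eqP/cabs_eq0->.
have -> : d - h^-1 *: (f (h *: (1 : R[i]^o) + z) - f z)
    = - (h^-1 * (f (z + h) - f z - h * d)).
  rewrite -[h *: _]/(h * 1) mulr1 (addrC h) -[_ *: _]/(h^-1 * _).
  by field.
rewrite cabsN cabsM -(ler_pM2l h00) mulrA -cabsM divff// cabs_real normr1 mul1r.
apply: (le_trans (fC h (ltW h1))).
rewrite expr2 mulrCA ler_wpM2l ?cabs_ge0//.
rewrite (le_trans (ler_norm _))// normrM (ger0_norm (cabs_ge0 h)).
rewrite (@le_trans _ _ ((`|C| + 1) * cabs h))//.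
  by rewrite ler_wpM2r ?cabs_ge0// lerDl.
by rewrite mulrC -ler_pdivlMr// ltW.
Qed.

Lemma entire_continuous f : entire f -> continuous (f : R[i]^o -> R[i]^o).
Proof. by move=> ef z; apply/differentiable_continuous/derivable1_diffP/ef. Qed.

Lemma Re_continuous : continuous (@complex.Re R : R[i]^o -> R).
Proof.
move=> z; apply/(@cvgrPdist_lt _ _ _ (nbhs (z : R[i]^o))) => e e0; apply/nbhs_cabsP;
  exists e => // u ur.
apply: le_lt_trans ur; rewrite distrC.
by case: u z => a b [c d]; exact: (Re_le_cabs ((a - c) +i* (b - d))).
Qed.

Lemma Im_continuous : continuous (@complex.Im R : R[i]^o -> R).
Proof.
move=> z; apply/(@cvgrPdist_lt _ _ _ (nbhs (z : R[i]^o))) => e e0; apply/nbhs_cabsP;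
  exists e => // u ur.
apply: le_lt_trans ur; rewrite distrC.
by case: u z => a b [c d]; exact: (Im_le_cabs ((a - c) +i* (b - d))).
Qed.

Lemma toC_continuous : continuous (@toC R : R * R -> R[i]^o).
Proof.
move=> p P /nbhs_cabsP[r r0 rP]; apply/nbhs_ballP; exists (r / 2) => /=.
  by rewrite divr_gt0.
move=> q [/= q1 q2]; apply: rP; apply: (le_lt_trans (cabs_le_l1 _)).
rewrite (splitr r) ltrD// distrC//.
Qed.

End ComplexTopology.

(** * Borel measurability on the plane *)

Section PlaneMeasurability.
Context {R : realType}.

(** The sigma-algebra on [R * R] is the product one, so an open set is written as a countable union
    of squares with rational centre and radius. *)
Lemma open_measurable_prod (U : set (R * R)) : open U -> measurable U.
Proof.
move=> oU.
pose box (q : rat * rat * rat) : set (R * R) :=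
  ball (ratr q.1.1 : R) (ratr q.2 : R) `*` ball (ratr q.1.2 : R) (ratr q.2 : R).
pose F q := if `[< box q `<=` U >] then box q else set0.
have -> : U = \bigcup_q F q.
  apply/seteqP; split=> [[x y] Uxy|p [q _]]; last first.
    by rewrite /F; case: asboolP => // qU; exact: qU.
  have /nbhs_ballP[e /= e0 eU] : nbhs (x, y) U by exact: open_nbhs_nbhs.
  (* With [r < e / 2], a square of radius [r] whose centre is within [r] of the point stays inside
     the [e]-ball. *)
  have [r /[!in_itv]/= /andP[r0 re]] := rat_in_itvoo (divr_gt0 e0 (@ltr0n R 2)).
  have near_rat (t : R) : exists q : rat, `|t - ratr q| < ratr r.
    have [|q /[!in_itv]/= /andP[q1 q2]] := @rat_in_itvoo R (t - ratr r) (t + ratr r).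
      by rewrite ltrD2l gtrN.
    by exists q; rewrite ltr_norml; apply/andP; split; lra.
  have [[a ax] [b yb]] := (near_rat x, near_rat y).
  exists (a, b, r) => //; rewrite /F.
  have bU : box (a, b, r) `<=` U.
    move=> [u v] [/= hu hv]; apply: eU; split => /=.
      have := ler_distD (ratr a) x u; rewrite /ball /ball_ /= in hu *; lra.
    have := ler_distD (ratr b) y v; rewrite /ball /ball_ /= in hv *; lra.
  by rewrite asboolT//; split; rewrite /= /ball /= distrC.
apply: countable_bigcupT_measurable => // q; rewrite /F; case: ifP => // _.
by apply: measurableX; exact: measurable_ball.
Qed.

Lemma continuous_measurable_fun_prod (f : R * R -> R) :
  continuous f -> measurable_fun setT f.
Proof.
move=> /continuousP cf; apply: (measurability _ (RGenOpens.measurableE R)).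
move=> _ [_ [a [b ->] <-]]; rewrite setTI; apply: open_measurable_prod.
exact/cf/interval_open.
Qed.

Lemma entire_measurable (f : R[i] -> R[i]) : entire f ->
  measurable_fun setT (fun w : R * R => complex.Re (f (toC w))) /\
  measurable_fun setT (fun w : R * R => complex.Im (f (toC w))).
Proof.
move=> /entire_continuous cf; split; apply: continuous_measurable_fun_prod => p.
  rewrite -[X in continuous_at _ X]/((@complex.Re R \o f : R[i]^o -> R) \o @toC R).
  apply: continuous_comp; first exact: toC_continuous.
  by apply: (@continuous_comp (R[i]^o) (R[i]^o) R); [exact: cf|exact: Re_continuous].
rewrite -[X in continuous_at _ X]/((@complex.Im R \o f : R[i]^o -> R) \o @toC R).
apply: continuous_comp; first exact: toC_continuous.
by apply: (@continuous_comp (R[i]^o) (R[i]^o) R); [exact: cf|exact: Im_continuous].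
Qed.

End PlaneMeasurability.

(** * Complex-valued integrals and normal families *)

Section ComplexIntegral.
Context d {T : measurableType d} {R : realType} (mu : {measure set T -> \bar R}).
Implicit Types (phi psi : T -> R[i]) (b : T -> R) (c : R[i]).

Definition cmeasurable phi :=
  measurable_fun setT (fun w => complex.Re (phi w)) /\
  measurable_fun setT (fun w => complex.Im (phi w)).

Definition cintegrable phi :=
  mu.-integrable setT (fun w => (complex.Re (phi w))%:E) /\
  mu.-integrable setT (fun w => (complex.Im (phi w))%:E).

(** For [phi = toep_integrand alpha mu f z] this is convertible to [Toeplitz alpha mu f z], and
    [cintegrable] to [toep_integrable], so the lemmas below apply to them directly. *)
Definition cint phi : R[i] :=
  Rintegral mu setT (fun w => complex.Re (phi w)) +i*
  Rintegral mu setT (fun w => complex.Im (phi w)).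

Lemma cmeasurableM phi psi :
  cmeasurable phi -> cmeasurable psi -> cmeasurable (fun w => phi w * psi w).
Proof.
move=> [phr phi_] [psr psi_]; split.
  rewrite [X in measurable_fun _ X](_ : _ = (fun w => complex.Re (phi w) *
    complex.Re (psi w) - complex.Im (phi w) * complex.Im (psi w))).
    by apply: measurable_funB; apply: measurable_funM.
  by apply/funext => w; case: (phi w) => ? ?; case: (psi w).
rewrite [X in measurable_fun _ X](_ : _ = (fun w => complex.Re (phi w) *
    complex.Im (psi w) + complex.Im (phi w) * complex.Re (psi w))).
  by apply: measurable_funD; apply: measurable_funM.
by apply/funext => w; case: (phi w) => ? ?; case: (psi w).
Qed.

Lemma cmeasurable_cst c : cmeasurable (fun=> c).
Proof. by split; exact: measurable_cst. Qed.

Lemma cmeasurable_real b : measurable_fun setT b -> cmeasurable (fun w => (b w)%:C).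
Proof. by move=> mb; split => //=; exact: measurable_cst. Qed.

Lemma cmeasurable_cexp phi : cmeasurable phi -> cmeasurable (fun w => cexp (phi w)).
Proof.
move=> [phr phi_]; split => /=; apply: measurable_funM.
- by apply: measurableT_comp => //; exact: measurable_expR.
- by apply: measurableT_comp => //; apply: continuous_measurable_fun; exact:
  continuous_cos.
- by apply: measurableT_comp => //; exact: measurable_expR.
- by apply: measurableT_comp => //; apply: continuous_measurable_fun; exact:
  continuous_sin.
Qed.

Lemma cintegrable_dom phi b : cmeasurable phi -> mu.-integrable setT (EFin \o b) ->
  (forall w, cabs (phi w) <= b w) -> cintegrable phi.
Proof.
move=> [mr mi] ib phib; split; apply: le_integrable ib => //.
- exact/measurable_EFinP.
- move=> w _ /=; rewrite lee_fin.
  by rewrite (le_trans (Re_le_cabs _))// (le_trans (phib w))// ler_norm.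
- exact/measurable_EFinP.
- move=> w _ /=; rewrite lee_fin.
  by rewrite (le_trans (Im_le_cabs _))// (le_trans (phib w))// ler_norm.
Qed.

Lemma norm_Rintegral_dom (f b : T -> R) :
  mu.-integrable setT (EFin \o f) -> mu.-integrable setT (EFin \o b) ->
  (forall w, `|f w| <= b w) ->
  `|Rintegral mu setT f| <= Rintegral mu setT b.
Proof.
move=> intf intb fb; apply: (le_trans (le_normr_Rintegral measurableT intf)).
by apply: le_Rintegral => //; exact: (integrable_norm intf).
Qed.

(** The factor 2 comes from bounding the real and imaginary parts separately; it is harmless for
    boundedness and decay. *)
Lemma cabs_cint_le phi b : cintegrable phi -> mu.-integrable setT (EFin \o b) ->
  (forall w, cabs (phi w) <= b w) -> cabs (cint phi) <= 2 * Rintegral mu setT b.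
Proof.
move=> [ir ii] ib phib; apply: (le_trans (cabs_le_l1 _)).
rewrite mulrDl mul1r lerD//; apply: norm_Rintegral_dom => // w.
  by rewrite (le_trans (Re_le_cabs _)).
by rewrite (le_trans (Im_le_cabs _)).
Qed.

Lemma cintegrableB phi psi : cintegrable phi -> cintegrable psi ->
  cintegrable (fun w => phi w - psi w).
Proof.
move=> [ar ai] [br bi]; split.
  apply: eq_integrable (integrableB measurableT ar br) => //= w _.
  by case: (phi w) => ? ?; case: (psi w).
apply: eq_integrable (integrableB measurableT ai bi) => //= w _.
by case: (phi w) => ? ?; case: (psi w).
Qed.

Lemma cintB phi psi : cintegrable phi -> cintegrable psi ->
  cint (fun w => phi w - psi w) = cint phi - cint psi.
Proof.
move=> [ar ai] [br bi]; rewrite /cint.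
transitivity ((Rintegral mu setT (fun w => complex.Re (phi w)) -
    Rintegral mu setT (fun w => complex.Re (psi w))) +i*
    (Rintegral mu setT (fun w => complex.Im (phi w)) -
    Rintegral mu setT (fun w => complex.Im (psi w)))) => //.
rewrite -!RintegralB//; congr (_ +i* _); apply: eq_Rintegral => w _;
  by case: (phi w) => ? ?; case: (psi w).
Qed.

Lemma integrable_scale e b : mu.-integrable setT (EFin \o b) ->
  mu.-integrable setT (EFin \o (fun w => e * b w)).
Proof. by move=> bi; apply: eq_integrable (integrableZl measurableT e bi). Qed.

Lemma cintegrableZ c phi : cintegrable phi -> cintegrable (fun w => c * phi w).
Proof.
case: c => x y [ir ii]; split.
  apply: eq_integrable (integrableB measurableT (integrableZl measurableT x ir)
    (integrableZl measurableT y ii)) => //= w _.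
  by case: (phi w).
apply: eq_integrable (integrableD measurableT (integrableZl measurableT x ii)
    (integrableZl measurableT y ir)) => //= w _.
by case: (phi w).
Qed.

Lemma cintZ c phi : cintegrable phi -> cint (fun w => c * phi w) = c * cint phi.
Proof.
case: c => x y [ir ii]; rewrite /cint.
transitivity ((x * Rintegral mu setT (fun w => complex.Re (phi w)) -
    y * Rintegral mu setT (fun w => complex.Im (phi w))) +i*
    (x * Rintegral mu setT (fun w => complex.Im (phi w)) +
    y * Rintegral mu setT (fun w => complex.Re (phi w)))) => //.
rewrite -!RintegralZl// -RintegralB ?integrable_scale// -RintegralD ?integrable_scale//.
by congr (_ +i* _); apply: eq_Rintegral => w _; case: (phi w).
Qed.

End ComplexIntegral.

(** * Normal families by limits along an ultrafilter *)

Section NormalFamily.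
Context {R : realType}.

(** Real and imaginary parts stay in a compact segment, where an ultrafilter has a cluster point,
    and a cluster point of an ultrafilter is its limit. *)
Lemma ultra_bounded_cvg (U : set_system nat) (a : nat -> R[i]) (C : R) :
  UltraFilter U -> (forall n, cabs (a n) <= C) ->
  exists l, forall e : R, 0 < e -> U [set n | cabs (a n - l) < e].
Proof.
move=> UU aC.
have C0 : 0 <= C by rewrite (le_trans (cabs_ge0 (a 0%N))).
have lim (b : nat -> R) : (forall n, `|b n| <= C) ->
    exists l : R, b @ U --> l.
  move=> bC; have [|l [_ bl]] := @segment_compact R (- C) C (b @ U) _.
    by apply: (@filterS _ U _ setT) filterT => n _ /=; rewrite in_itv/= -ler_norml.
  exists l; apply/cvgrPdist_lt => e e0.
  (* An ultrafilter contains this set or its complement; the complement would keep the values at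
     distance at least [e] from the cluster point. *)
  have [//|far] := in_ultra_setVsetC [set n | `|l - b n| < e] UU.
  have [|y [/= yl]] := bl [set y | e <= `|l - y|] (ball l e) _ (nbhsx_ballx _ _ e0).
    by apply: (@filterS _ U) far => n /=; rewrite leNgt => /negP.
  by rewrite /ball /= ltNge yl.
have [|x ax] := lim (fun n => complex.Re (a n)).
  by move=> n; rewrite (le_trans (Re_le_cabs _)).
have [|y ay] := lim (fun n => complex.Im (a n)).
  by move=> n; rewrite (le_trans (Im_le_cabs _)).
exists (x +i* y) => e e0; have e20 : 0 < e / 2 by rewrite divr_gt0.
move/cvgrPdist_lt : ax => /(_ _ e20) ax; move/cvgrPdist_lt : ay => /(_ _ e20) ay.
apply: filterS2 ax ay => n ax ay; apply: (le_lt_trans (cabs_le_l1 _)).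
rewrite (splitr e) ltrD//.
  by rewrite distrC in ax; case: (a n) ax.
by rewrite distrC in ay; case: (a n) ay.
Qed.

Lemma lipschitz_of_quadratic (g : R[i] -> R[i]) z d (C : R) :
  cabs d <= C ->
  (forall h, cabs h <= 1 -> cabs (g (z + h) - g z - h * d) <= C * cabs h ^+ 2) ->
  forall h, cabs h <= 1 -> cabs (g (z + h) - g z) <= 2 * C * cabs h.
Proof.
move=> dC gC h h1.
have -> : g (z + h) - g z = (g (z + h) - g z - h * d) + h * d by rewrite subrK.
rewrite (le_trans (cabsD _ _))// (le_trans (lerD (gC h h1) (lexx _)))// cabsM.
have h0 := cabs_ge0 h; have d0 := cabs_ge0 d.
have C0 := le_trans d0 dC; have Ch := mulr_ge0 C0 h0.
rewrite expr2 mulrA; have := ler_wpM2l Ch h1; have := ler_wpM2r h0 dC; lra.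
Qed.

(** What Cauchy's estimates would supply for a locally bounded family of entire functions: [D n]
    acts as the derivative of [g n], and [C] depends on the disc but not on [n]. *)
Definition locally_quadratic (g D : nat -> R[i] -> R[i]) :=
  forall r : R, exists C : R, forall n z, cabs z <= r ->
    [/\ cabs (g n z) <= C, cabs (D n z) <= C &
      forall h, cabs h <= 1 ->
        cabs (g n (z + h) - g n z - h * D n z) <= C * cabs h ^+ 2].

(** Both [g n] and [D n] have pointwise limits along [U], and the quadratic estimate survives the
    limit, so the limit is entire. Equal Lipschitz constants and compactness upgrade pointwise to
    uniform convergence on discs. *)
Lemma locally_quadratic_limit g D (U : set_system nat) : UltraFilter U ->
  locally_quadratic g D ->
  exists2 g0 : R[i] -> R[i], entire g0 &
    (forall (k : nat) (e : R), 0 < e ->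
      U [set n | forall z, cabs z <= k%:R -> cabs (g n z - g0 z) <= e]).
Proof.
move=> UU gD.
have /choice[g0 gl] (z : R[i]) : exists l, forall e : R, 0 < e ->
    U [set n | cabs (g n z - l) < e].
  have [C HC] := gD (cabs z).
  by apply: (@ultra_bounded_cvg _ _ C) => n; have [] := HC n z (lexx _).
have /choice[d dl] (z : R[i]) : exists l, forall e : R, 0 < e ->
    U [set n | cabs (D n z - l) < e].
  have [C HC] := gD (cabs z).
  by apply: (@ultra_bounded_cvg _ _ C) => n; have [] := HC n z (lexx _).
have quad (r : R) : exists C : R, forall z, cabs z <= r -> cabs (d z) <= C /\
    forall h, cabs h <= 1 -> cabs (g0 (z + h) - g0 z - h * d z) <= C * cabs h ^+ 2.
  have [C HC] := gD r; exists C => z zr; split.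
    apply/ler_addgt0Pr => e e0.
    have [n /= dn] := filter_ex (dl z e e0).
    have [_ Dn _] := HC n z zr.
    have -> : d z = D n z - (D n z - d z) by ring.
    by rewrite (le_trans (cabsB _ _))// lerD// ltW.
  move=> h h1; apply/ler_addgt0Pr => e e0.
  (* Three limits are replaced by terms of one common index: [g] at [z + h], [g] at [z], and [D] at
     [z]. *)
  have e30 : 0 < e / 3 by rewrite divr_gt0.
  have : U ([set n | cabs (g n (z + h) - g0 (z + h)) < e / 3] `&`
    ([set n | cabs (g n z - g0 z) < e / 3] `&`
     [set n | cabs (D n z - d z) < e / 3])) by apply: filterI; [exact: gl|apply:
       filterI; [exact: gl|exact: dl]].
  move=> /filter_ex[n [/= n1 [n2 n3]]].
  have [_ _ /(_ h h1) q] := HC n z zr.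
  have -> : g0 (z + h) - g0 z - h * d z = (g n (z + h) - g n z - h * D n z)
    - (g n (z + h) - g0 (z + h)) + (g n z - g0 z) + h * (D n z - d z) by ring.
  rewrite (le_trans (cabsD _ _))// (le_trans (lerD (cabsD _ _) (lexx _)))//.
  rewrite (le_trans (lerD (lerD (cabsB _ _) (lexx _)) (lexx _)))// cabsM.
  have : cabs h * cabs (D n z - d z) <= cabs (D n z - d z).
    by rewrite ler_piMl// cabs_ge0.
  by move: q n1 n2 n3; clear; lra.
exists g0.
  move=> z; have [C HC] := quad (cabs z); have [_ q] := HC z (lexx _).
  exact: derivable_of_quadratic_remainder q.
move=> k e e0; have [C1 H1] := gD (2 * k%:R); have [C2 H2] := quad (2 * k%:R).
(* This square contains the disc of radius [k] and its points have modulus at most [2 k], whence the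
   constants taken for radius [2 * k]. *)
pose K := (`[- k%:R, k%:R] `*` `[- k%:R, k%:R] : set (R * R)).
have cK : compact K by apply: compact_setX; exact: segment_compact.
have cov p : K p ->
    \forall q \near p & n \near U, cabs (g n (toC q) - g0 (toC q)) <= e.
  move=> [/= ]; rewrite !in_itv/= -!ler_norml => p1 p2.
  have pk : cabs (toC p) <= 2 * k%:R.
    by rewrite (le_trans (cabs_le_l1 _))//= mulrDl mul1r lerD.
  have L n u : cabs u <= 1 -> cabs (g n (toC p + u) - g n (toC p)) <= 2 * C1 * cabs u.
    have [_ Dn q] := H1 n _ pk; exact: (lipschitz_of_quadratic Dn q).
  have L0 u : cabs u <= 1 -> cabs (g0 (toC p + u) - g0 (toC p)) <= 2 * C2 * cabs u.
    have [Dn q] := H2 _ pk; exact: (lipschitz_of_quadratic Dn q).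
  have c1 : 0 <= C1 by have [+ _ _] := H1 0%N _ pk; apply: le_trans; exact: cabs_ge0.
  have c2 : 0 <= C2 by have [+ _] := H2 _ pk; apply: le_trans; exact: cabs_ge0.
  (* The Lipschitz constants of [g n] and of [g0] together, plus one for positivity: moving from [p]
     to [q] costs [e / 2], and convergence at [p] the other half. *)
  pose A := 2 * C1 + 2 * C2 + 1.
  have A0 : 0 < A by rewrite /A; lra.
  have e20 : 0 < e / 2 by rewrite divr_gt0.
  pose r := Num.min 1 (e / 2 / A).
  have r0 : 0 < r by rewrite lt_min ltr01 divr_gt0.
  have npr : nbhs p [set q | cabs (toC q - toC p) < r].
    apply: (@toC_continuous R p [set u | cabs (u - toC p) < r]).
    by apply/nbhs_cabsP; exists r.
  exists ([set q | cabs (toC q - toC p) < r],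
    [set n | cabs (g n (toC p) - g0 (toC p)) < e / 2]).
    by split=> //=; exact: gl.
  move=> [q n] /= []; rewrite lt_min => /andP[q1 qr] gn.
  pose u := toC q - toC p.
  have qE : toC q = toC p + u by rewrite /u addrC subrK.
  rewrite -/u in q1 qr; rewrite qE.
  have -> : g n (toC p + u) - g0 (toC p + u) = (g n (toC p + u) - g n (toC p))
    - (g0 (toC p + u) - g0 (toC p)) + (g n (toC p) - g0 (toC p)) by ring.
  rewrite (le_trans (cabsD _ _))// (le_trans (lerD (cabsB _ _) (lexx _)))//.
  have l1 := L n u (ltW q1); have l2 := L0 u (ltW q1).
  have uA : cabs u * A <= e / 2 by rewrite -ler_pdivlMr// ltW.
  have u0 := cabs_ge0 u.
  move: uA; rewrite /A !mulrDr mulr1 => uA.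
  rewrite [cabs u * (2 * C1)]mulrC [cabs u * (2 * C2)]mulrC in uA.
  move: l1 l2 gn uA u0; clear; lra.
(* Compactness in its near-covering form makes the local estimates hold on all of [K] for a common
   set of indices in [U]. *)
have KU : U [set n | K `<=` [set p | cabs (g n (toC p) - g0 (toC p)) <= e]].
  exact: ((compact_near_coveringP K).1 cK nat U
    (fun n p => cabs (g n (toC p) - g0 (toC p)) <= e) _ cov).
apply: filterS KU => n Kn z zk.
have := Kn (complex.Re z, complex.Im z); case: z zk => a b zk; apply.
by split; rewrite /= in_itv/= -ler_norml (le_trans _ zk)//;
  [exact: (Re_le_cabs (a +i* b))|exact: (Im_le_cabs (a +i* b))].
Qed.

(** An ultrafilter finer than [\oo] contains every tail, so each of its sets has arbitrarily large
    members: an actual subsequence can be picked, with error [1 / (k + 1)] on the disc of radius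
    [k]. *)
Lemma locally_quadratic_subseq g D : locally_quadratic g D ->
  exists (phi : nat -> nat) (g0 : R[i] -> R[i]),
    [/\ {homo phi : m n / (m < n)%N}, entire g0 &
      forall (k : nat) z, cabs z <= k%:R -> cabs (g (phi k) z - g0 z) <= k.+1%:R^-1].
Proof.
move=> gD; have [U [UU oU]] := @ultraFilterLemma nat \oo _.
have [g0 eg0 gg0] := locally_quadratic_limit UU gD.
have sel N k : exists n, (N <= n)%N /\
    forall z, cabs z <= k%:R -> cabs (g n z - g0 z) <= k.+1%:R^-1.
  have : U ([set n | (N <= n)%N] `&`
    [set n | forall z, cabs z <= k%:R -> cabs (g n z - g0 z) <= k.+1%:R^-1]).
    apply: filterI; last by apply: gg0; rewrite invr_gt0.
    by apply: oU; exists N.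
  by move=> /filter_ex[n [/= ? ?]]; exists n.
pose s N k := projT1 (cid (sel N k)).
have sP N k := projT2 (cid (sel N k)).
(* Searching from [(phi k').+1] onwards forces strict monotonicity. *)
pose phi := fix phi k := if k is k'.+1 then s (phi k').+1 k else s 0 0%N.
exists phi, g0; split => //.
  by apply: homo_ltn; [exact: ltn_trans|move=> k /=; have [] := sP (phi k).+1 k.+1].
by case=> [|k]; [have [] := sP 0%N 0%N|have [] := sP (phi k).+1 k.+1].
Qed.

End NormalFamily.

(** * Gaussian weights *)

Section GaussianWeights.
Context {R : realType} (alpha : R) (alpha0 : 0 < alpha).
Implicit Types (z h a : R[i]) (w : R * R).

Definition gauss z w : R := expR (- alpha * cnorm2 (z - toC w) / 2).

Definition l1norm w : R := `|w.1| + `|w.2|.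

(** The common dominating function: with [rho = alpha * r] it majorizes all Gaussians centred in the
    disc of radius [r], and a larger [rho] absorbs polynomial factors. *)
Definition gauss_weight (rho : R) w : R :=
  expR (rho * l1norm w) * expR (- alpha * cnorm2 (toC w) / 2).

Lemma gaussE z w : gauss z w = expR (- alpha *
  ((complex.Re z - w.1) ^+ 2 + (complex.Im z - w.2) ^+ 2) / 2).
Proof. by rewrite /gauss; case: z w => x y [u v]. Qed.

Lemma gauss_ge0 z w : 0 <= gauss z w. Proof. exact: expR_ge0. Qed.

Lemma gauss_weight_ge0 rho w : 0 <= gauss_weight rho w.
Proof. by rewrite mulr_ge0// expR_ge0. Qed.

Lemma gauss_le1 z w : gauss z w <= 1.
Proof.
rewrite -expR0 ler_expR mulNr mulNr oppr_le0.
by rewrite divr_ge0// mulr_ge0 ?(ltW alpha0)// -sqr_cabs sqr_ge0.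
Qed.

Lemma l1norm_ge0 w : 0 <= l1norm w. Proof. by rewrite addr_ge0. Qed.

Lemma cabs_toC_le w : cabs (toC w) <= l1norm w.
Proof. exact: (cabs_le_l1 (toC w)). Qed.

Lemma measurable_fst_snd :
  measurable_fun setT (fun w : R * R => w.1) /\
  measurable_fun setT (fun w : R * R => w.2).
Proof. by split; [exact: measurable_fst|exact: measurable_snd]. Qed.

Lemma measurable_cnorm2 z : measurable_fun setT (fun w => cnorm2 (z - toC w)).
Proof.
have [m1 m2] := measurable_fst_snd.
case: z => x y; apply: measurable_funD; apply: measurable_funX;
  exact: measurable_funB.
Qed.

Lemma measurable_gauss z : measurable_fun setT (gauss z).
Proof.
apply: measurableT_comp; first exact: measurable_expR.
by do 2 apply: measurable_funM => //; exact: measurable_cnorm2.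
Qed.

Lemma measurable_gauss_weight rho : measurable_fun setT (gauss_weight rho).
Proof.
have [m1 m2] := measurable_fst_snd.
apply: measurable_funM; (apply: measurableT_comp; first exact: measurable_expR).
  apply: measurable_funM => //.
  by apply: measurable_funD; apply: measurableT_comp => //; exact: normr_measurable.
do 2 apply: measurable_funM => //.
by apply: measurable_funD; apply: measurable_funX.
Qed.

(** By [1 + t <= expR t], each factor of size [|w|] costs one unit of [rho]. *)
Lemma gauss_weightS rho w :
  (1 + l1norm w) * gauss_weight rho w <= gauss_weight (rho + 1) w.
Proof.
rewrite /gauss_weight [(rho + 1) * _]mulrDl mul1r expRD [X in _ <= X * _]mulrC -!mulrA.
by rewrite ler_wpM2r ?mulr_ge0 ?expR_ge0// expR_ge1Dx.
Qed.

(** Expanding the square, the term in [|z|^2] is dropped and the cross term is at most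
    [alpha * r * l1norm w]. *)
Lemma gauss_le_weight r z w : cabs z <= r -> gauss z w <= gauss_weight (alpha * r) w.
Proof.
move=> zr; rewrite gaussE /gauss_weight -expRD ler_expR /cnorm2 /l1norm /=.
have := le_trans (Re_le_cabs z) zr; have := le_trans (Im_le_cabs z) zr.
move: (complex.Re z) (complex.Im z) => x y yr xr.
have r0 := le_trans (normr_ge0 _) xr.
have h1 : x * w.1 <= r * `|w.1|.
  by rewrite (le_trans (ler_norm _))// normrM ler_wpM2r.
have h2 : y * w.2 <= r * `|w.2|.
  by rewrite (le_trans (ler_norm _))// normrM ler_wpM2r.
have h3 : 0 <= alpha * (x ^+ 2 + y ^+ 2).
  by rewrite mulr_ge0 ?(ltW alpha0)// addr_ge0// sqr_ge0.
have h4 : 0 <= alpha * (r * `|w.1| - x * w.1 + (r * `|w.2| - y * w.2)).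
  by rewrite mulr_ge0 ?(ltW alpha0)// addr_ge0// subr_ge0.
rewrite -subr_ge0 [X in 0 <= X](_ : _ = alpha * (x ^+ 2 + y ^+ 2) / 2 +
  alpha * (r * `|w.1| - x * w.1 + (r * `|w.2| - y * w.2))); last by field.
by rewrite addr_ge0// divr_ge0.
Qed.

(** In each quadrant [l1norm] is linear, and completing the square gives a Gaussian centred at one
    of the four points with coordinates [rho / alpha] up to sign. Integrability of the weight thus
    reduces to that of Gaussians. *)
Lemma gauss_weight_le_gauss rho w :
  gauss_weight rho w <= expR (rho ^+ 2 / alpha) *
    (gauss (rho / alpha +i* (rho / alpha)) w + gauss (rho / alpha +i* (- rho / alpha)) w +
    (gauss (- rho / alpha +i* (rho / alpha)) w + gauss (- rho / alpha +i* (- rho /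
      alpha)) w)).
Proof.
have key (s t : R) : s ^+ 2 = 1 -> t ^+ 2 = 1 -> s * w.1 = `|w.1| -> t * w.2 = `|w.2| ->
    gauss_weight rho w = expR (rho ^+ 2 / alpha) *
      gauss (s * rho / alpha +i* (t * rho / alpha)) w.
  move=> s1 t1 su tv; rewrite gaussE /gauss_weight -!expRD; congr expR.
  rewrite /= /cnorm2 /l1norm /= -su -tv.
  have -> : (s * rho / alpha - w.1) ^+ 2 =
      (rho / alpha) ^+ 2 * s ^+ 2 - 2 * (s * rho / alpha * w.1) + w.1 ^+ 2 by ring.
  have -> : (t * rho / alpha - w.2) ^+ 2 =
      (rho / alpha) ^+ 2 * t ^+ 2 - 2 * (t * rho / alpha * w.2) + w.2 ^+ 2 by ring.
  by rewrite s1 t1; field; rewrite gt_eqF.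
have one2 : (1 : R) ^+ 2 = 1 by rewrite expr1n.
have onem2 : (-1 : R) ^+ 2 = 1 by rewrite sqrrN expr1n.
have g0 z := gauss_ge0 z w.
have [u0|/ltW u0] := leP 0 w.1; have [v0|/ltW v0] := leP 0 w.2.
- rewrite (key 1 1) ?mul1r ?ger0_norm// ler_wpM2l ?expR_ge0//.
  by rewrite -addrA lerDl !addr_ge0.
- rewrite (key 1 (-1)) ?mulN1r ?mul1r ?(ger0_norm u0) ?(ler0_norm v0)// ler_wpM2l
  ?expR_ge0//.
  by rewrite -addrA addrCA lerDl !addr_ge0.
- rewrite (key (-1) 1) ?mulN1r ?mul1r ?(ger0_norm v0) ?(ler0_norm u0)// ler_wpM2l
  ?expR_ge0//.
  by rewrite addrCA lerDl !addr_ge0.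
- rewrite (key (-1) (-1)) ?mulN1r ?ler0_norm// ler_wpM2l ?expR_ge0//.
  by rewrite addrA lerDr !addr_ge0.
Qed.

(** The bound [|expR s - expR t| <= |s - t| (expR s + expR t)] applies to exponents whose difference
    is [h] times an affine function of [w]; the weight absorbs that growth. *)
Lemma gauss_lipschitz r z h w : cabs z <= r -> cabs h <= 1 ->
  `|gauss (z + h) w - gauss z w| <=
  cabs h * (4 * alpha * (r + 1) * gauss_weight (alpha * (r + 1) + 1) w).
Proof.
move=> zr h1.
have r0 : 0 <= r := le_trans (cabs_ge0 z) zr.
have zhr : cabs (z + h) <= r + 1 by rewrite (le_trans (cabsD _ _))// lerD.
have g1 := gauss_le_weight w zhr.
have g2 : gauss z w <= gauss_weight (alpha * (r + 1)) w.
  by apply: gauss_le_weight; rewrite (le_trans zr)// lerDl.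
have expR_lip (s t : R) : `|expR s - expR t| <= `|s - t| * (expR s + expR t).
  wlog st : s t / t <= s.
    move=> H; have [/H//|/ltW /H] := leP t s.
    by rewrite distrC [`|t - s|]distrC [expR t + _]addrC.
  rewrite !ger0_norm ?subr_ge0 ?ler_expR//.
  have e0 := expR_gt0 s; have e1 := expR_gt0 t.
  have : (1 + (t - s)) * expR s <= expR t.
    by rewrite -{2}(subrK s t) expRD ler_wpM2r ?(ltW e0)// expR_ge1Dx.
  have st0 : 0 <= s - t by rewrite subr_ge0.
  by have := mulr_ge0 st0 (ltW e1); lra.
apply: (le_trans (expR_lip _ _)); rewrite -!/(gauss _ _).
have -> : - alpha * cnorm2 (z + h - toC w) / 2 - - alpha * cnorm2 (z - toC w) / 2
  = - alpha / 2 * (complex.Re h * (2 * (complex.Re z - w.1) + complex.Re h) +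
                   complex.Im h * (2 * (complex.Im z - w.2) + complex.Im h)).
  by case: z h w {zr h1 zhr g1 g2} => a b [c d] [u v]; rewrite /cnorm2 /=; field.
have L0 := l1norm_ge0 w.
have e1 : `|- alpha / 2 * (complex.Re h * (2 * (complex.Re z - w.1) + complex.Re h) +
    complex.Im h * (2 * (complex.Im z - w.2) + complex.Im h))| <=
    cabs h * (alpha * (4 * (r + 1) * (1 + l1norm w)) / 2).
  rewrite normrM normrM normrN (gtr0_norm alpha0) (@ger0_norm _ 2^-1)//.
  rewrite [X in _ <= X](_ : _ = alpha / 2 * (cabs h * (4 * (r + 1) * (1 + l1norm w))));
    last by ring.
  rewrite ler_wpM2l ?divr_ge0 ?(ltW alpha0)// (le_trans (ler_normD _ _))// !normrM.
  have hR := Re_le_cabs h; have hI := Im_le_cabs h.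
  have zR := le_trans (Re_le_cabs z) zr; have zI := le_trans (Im_le_cabs z) zr.
  rewrite (@le_trans _ _ (cabs h * (2 * (r + `|w.1|) + 1) + cabs h * (2 * (r + `|w.2|)
    + 1)))//.
    have aux (p q s : R) : `|p| <= r -> `|s| <= cabs h ->
        `|s| * `|2 * (p - q) + s| <= cabs h * (2 * (r + `|q|) + 1).
      move=> pr sh; apply: ler_pM => //; rewrite (le_trans (ler_normD _ _))//.
      rewrite lerD ?(le_trans sh)// normrM (@ger0_norm _ 2)// ler_wpM2l//.
      by rewrite (le_trans (ler_normB _ _))// lerD.
    by apply: lerD; exact: aux.
  rewrite -mulrDr ler_wpM2l ?cabs_ge0//.
  rewrite /l1norm in L0 *.
  move: (mulr_ge0 r0 L0); move: L0 r0; move: `|w.1| `|w.2| => p q; clear.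
  by rewrite !mulrDr !mulrDl !mul1r !mulr1; lra.
apply: (le_trans (ler_pM _ _ e1 (lerD g1 g2))) => //.
  by rewrite addr_ge0// gauss_ge0.
rewrite -[X in X <= _]mulrA ler_wpM2l ?cabs_ge0//.
rewrite [X in X <= _](_ : _ = 4 * alpha * (r + 1) *
  ((1 + l1norm w) * gauss_weight (alpha * (r + 1)) w)); last by field.
by rewrite ler_wpM2l ?gauss_weightS// !mulr_ge0 ?(ltW alpha0)// addr_ge0.
Qed.

End GaussianWeights.

(** * Estimates for the Toeplitz operator *)

Section FockNorm.
Context {R : realType} (alpha : R).
Implicit Types (f : R[i] -> R[i]) (z : R[i]).

Lemma fock_norm_leP f (M : R) : (fock_norm alpha f <= M%:E)%E <->
  forall z, cabs (f z) * expR (- alpha * cnorm2 z / 2) <= M.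
Proof.
split=> [fM z|fM].
  rewrite -lee_fin; apply: le_trans fM; apply: ereal_sup_ubound.
  by exists z.
by apply: ub_ereal_sup => _ [z _ <-]; rewrite lee_fin.
Qed.

Lemma fock_norm_ge0 f : (0 <= fock_norm alpha f)%E.
Proof.
apply: (@le_trans _ _ (cabs (f 0) * expR (- alpha * cnorm2 0 / 2))%:E).
  by rewrite lee_fin mulr_ge0 ?cabs_ge0 ?expR_ge0.
by apply: ereal_sup_ubound; exists 0.
Qed.

Lemma in_FinfP f : in_Finf alpha f <->
  entire f /\ exists2 M : R, 0 <= M & (fock_norm alpha f <= M%:E)%E.
Proof.
split=> [[ef fy]|[ef [M M0 fM]]]; split => //.
  exists (fine (fock_norm alpha f)); first by rewrite fine_ge0// fock_norm_ge0.
  by rewrite fineK// ge0_fin_numE// fock_norm_ge0.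
by rewrite (le_lt_trans fM)// ltry.
Qed.

Lemma cabs_le_of_fock_norm f (M : R) : (fock_norm alpha f <= M%:E)%E ->
  forall z, cabs (f z) <= M * expR (alpha * cnorm2 z / 2).
Proof.
move=> /fock_norm_leP fM z; rewrite -ler_pdivrMr ?expR_gt0// -expRN.
by rewrite -!mulNr.
Qed.

End FockNorm.

(** * Pointwise bounds for the Toeplitz integrand *)

Section ToeplitzIntegrand.
Context {R : realType} (alpha : R) (alpha0 : 0 < alpha)
  (mu : {measure set (R * R) -> \bar R}).
Implicit Types (f : R[i] -> R[i]) (z h : R[i]) (w : R * R).

Lemma cmeasurable_conj_toC : cmeasurable (fun w : R * R => (toC w)^*).
Proof.
have [m1 m2] := @measurable_fst_snd R; split => //=.
exact: measurable_funN.
Qed.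

(** Conjugating the kernel makes it an exponential of a function linear in [z], to which the Taylor
    estimate for [cexp] applies. *)
Lemma toep_integrandE f z w : toep_integrand alpha mu f z w =
  f (toC w) * cexp (alpha%:C * (z * (toC w)^*)) * (expR (- alpha * cnorm2 (toC w)))%:C.
Proof.
congr (_ * _ * _); apply: (etrans (conj_cexp _)); congr cexp.
case: z (toC w) => a b [u v]; apply/eqP; rewrite eq_complex /=.
by apply/andP; split; apply/eqP; ring.
Qed.

Lemma cmeasurable_expR_cnorm2 :
  cmeasurable (fun w : R * R => (expR (- alpha * cnorm2 (toC w)))%:C).
Proof.
apply: cmeasurable_real; have [m1 m2] := @measurable_fst_snd R.
apply: measurableT_comp; first exact: measurable_expR.
apply: measurable_funM => //.
by apply: measurable_funD; apply: measurable_funX.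
Qed.

Lemma cmeasurable_toep f z : cmeasurable (fun w => f (toC w)) ->
  cmeasurable (toep_integrand alpha mu f z).
Proof.
move=> mf; have -> : toep_integrand alpha mu f z = (fun w => f (toC w) *
    cexp (alpha%:C * (z * (toC w)^*)) * (expR (- alpha * cnorm2 (toC w)))%:C).
  by apply/funext => w; rewrite toep_integrandE.
apply: cmeasurableM; last exact: cmeasurable_expR_cnorm2.
apply: cmeasurableM => //; apply: cmeasurable_cexp.
apply: cmeasurableM; first exact: cmeasurable_cst.
by apply: cmeasurableM; [exact: cmeasurable_cst|exact: cmeasurable_conj_toC].
Qed.

(** The growth of [f], the modulus of the kernel and the weight combine by completing the square
    around [z]. *)
Lemma cabs_toep_le f (M : R) z w : (fock_norm alpha f <= M%:E)%E ->
  cabs (toep_integrand alpha mu f z w) <=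
  M * expR (alpha * cnorm2 z / 2) * gauss alpha z w.
Proof.
move=> /cabs_le_of_fock_norm/(_ (toC w)) fM.
rewrite toep_integrandE !cabsM cabs_cexp cabs_real (ger0_norm (expR_ge0 _)).
rewrite -[leLHS]mulrA -expRD.
apply: (le_trans (ler_wpM2r (expR_ge0 _) fM)).
rewrite -!mulrA /gauss -!expRD le_eqVlt; apply/orP; left; apply/eqP; congr (_ * expR _).
by case: z w {fM} => a b [u v]; rewrite /cnorm2 /=; field.
Qed.

(** The candidate for the derivative of [Toeplitz alpha mu f], obtained by differentiating under the
    integral sign. *)
Definition toep_deriv f z : R[i] :=
  cint mu (fun w => alpha%:C * (toC w)^* * toep_integrand alpha mu f z w).

Lemma cabs_kernel_arg z w : cabs (alpha%:C * (z * (toC w)^*)) <= alpha * (cabs z *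
  l1norm w).
Proof.
rewrite !cabsM cabs_conj cabs_real gtr0_norm// !ler_wpM2l ?cabs_ge0 ?(ltW alpha0)//.
exact: cabs_toC_le.
Qed.

Lemma cabs_toep_weight f (M r : R) z w : (fock_norm alpha f <= M%:E)%E -> 0 <= M ->
  cabs z <= r ->
  cabs (toep_integrand alpha mu f z w) <= M * gauss_weight alpha (alpha * r) w.
Proof.
move=> /cabs_le_of_fock_norm/(_ (toC w)) fM M0 zr.
rewrite toep_integrandE !cabsM cabs_cexp cabs_real (ger0_norm (expR_ge0 _)).
rewrite -[leLHS]mulrA -expRD.
apply: (le_trans (ler_wpM2r (expR_ge0 _) fM)).
rewrite /gauss_weight -[leLHS]mulrA ler_wpM2l// -!expRD ler_expR.
have : complex.Re (alpha%:C * (z * (toC w)^*)) <= alpha * r * l1norm w.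
  rewrite (le_trans (ler_norm _))// (le_trans (Re_le_cabs _))//.
  rewrite (le_trans (cabs_kernel_arg _ _))// -mulrA ler_wpM2l ?(ltW alpha0)//.
  by rewrite ler_wpM2r ?l1norm_ge0.
by move: (complex.Re _) (cnorm2 _) => A B; clear; lra.
Qed.

Lemma cabs_toep_deriv_le f (M r : R) z w : (fock_norm alpha f <= M%:E)%E -> 0 <= M ->
  cabs z <= r ->
  cabs (alpha%:C * (toC w)^* * toep_integrand alpha mu f z w) <=
  M * alpha * gauss_weight alpha (alpha * r + 1) w.
Proof.
move=> fM M0 zr; rewrite cabsM.
have := cabs_toep_weight w fM M0 zr.
rewrite cabsM cabs_conj cabs_real gtr0_norm// => tM.
apply: (le_trans (ler_pM _ _ (lexx _) tM)); rewrite ?mulr_ge0 ?cabs_ge0 ?(ltW alpha0)//.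
rewrite [leLHS](_ : _ = M * alpha *
  (cabs (toC w) * gauss_weight alpha (alpha * r) w)); last by ring.
rewrite ler_wpM2l ?mulr_ge0 ?(ltW alpha0)//.
apply: le_trans (gauss_weightS _ _ _).
rewrite ler_wpM2r ?gauss_weight_ge0// (le_trans (cabs_toC_le w))//.
by rewrite lerDr.
Qed.

(** Taylor's estimate for [cexp] with increment [V = alpha h conj(w)]: [|V|^2] gives [|h|^2] and two
    factors [|w|], hence the [+ 2]; the factor [expR |V|] turns [r] into [r + 1]. *)
Lemma toep_remainder_le f (M r : R) z h w :
  (fock_norm alpha f <= M%:E)%E -> 0 <= M -> cabs z <= r -> cabs h <= 1 ->
  cabs (toep_integrand alpha mu f (z + h) w - toep_integrand alpha mu f z w
    - h * (alpha%:C * (toC w)^* * toep_integrand alpha mu f z w)) <=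
  M * (4 * alpha ^+ 2) * cabs h ^+ 2 * gauss_weight alpha (alpha * (r + 1) + 2) w.
Proof.
move=> /cabs_le_of_fock_norm/(_ (toC w)) fM M0 zr h1; rewrite !toep_integrandE.
set U := alpha%:C * (z * (toC w)^*); pose V := alpha%:C * (h * (toC w)^*).
have -> : alpha%:C * ((z + h) * (toC w)^*) = U + V by rewrite /U /V; ring.
set E := (expR (- alpha * cnorm2 (toC w)))%:C.
have -> : f (toC w) * cexp (U + V) * E - f (toC w) * cexp U * E -
   h * (alpha%:C * (toC w)^* * (f (toC w) * cexp U * E)) =
   f (toC w) * E * (cexp (U + V) - cexp U - V * cexp U) by rewrite /V; ring.
rewrite !cabsM cabs_real (ger0_norm (expR_ge0 _)).
have L0 := l1norm_ge0 w; have r0 := le_trans (cabs_ge0 z) zr.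
have a0 := ltW alpha0.
have Vh : cabs V <= alpha * (cabs h * l1norm w) := cabs_kernel_arg h w.
have UV : complex.Re U + cabs V <= alpha * (r + 1) * l1norm w.
  rewrite -mulrA mulrDl mulrDr lerD//.
    rewrite (le_trans (ler_norm _))// (le_trans (Re_le_cabs _))//.
    by rewrite (le_trans (cabs_kernel_arg _ _))// ler_wpM2l// ler_wpM2r.
  by rewrite (le_trans Vh)// ler_wpM2l// ler_wpM2r.
have e1 : cabs (f (toC w)) * expR (- alpha * cnorm2 (toC w)) <=
    M * expR (- alpha * cnorm2 (toC w) / 2).
  apply: (le_trans (ler_wpM2r (expR_ge0 _) fM)); rewrite -[leLHS]mulrA -expRD.
  rewrite ler_wpM2l// ler_expR; move: (cnorm2 _) => A; clear; lra.
have e2 : cabs (cexp (U + V) - cexp U - V * cexp U) <=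
    4 * (alpha * (cabs h * l1norm w)) ^+ 2 * expR (alpha * (r + 1) * l1norm w).
  apply: (le_trans (cexp_taylor_le _ _)).
  apply: ler_pM; rewrite ?expR_ge0 ?ler_expR//; first by rewrite mulr_ge0// sqr_ge0.
  by rewrite ler_wpM2l// lerXn2r ?nnegrE ?cabs_ge0// !mulr_ge0 ?cabs_ge0.
apply: (le_trans (ler_pM _ _ e1 e2)).
- by rewrite mulr_ge0 ?cabs_ge0 ?expR_ge0.
- exact: cabs_ge0.
rewrite [leLHS](_ : _ = M * (4 * alpha ^+ 2) * cabs h ^+ 2 *
  (l1norm w * (l1norm w * gauss_weight alpha (alpha * (r + 1)) w))); last first.
  by rewrite /gauss_weight; ring.
rewrite ler_wpM2l ?mulr_ge0 ?sqr_ge0 ?cabs_ge0//.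
have G rho : l1norm w * gauss_weight alpha rho w <= gauss_weight alpha (rho + 1) w.
  apply: le_trans (gauss_weightS _ _ _).
  by rewrite ler_wpM2r ?gauss_weight_ge0// lerDr.
rewrite [_ + 2](_ : _ = alpha * (r + 1) + 1 + 1); last by ring.
by apply: le_trans (G _); rewrite ler_wpM2l.
Qed.

End ToeplitzIntegrand.

(** * The Toeplitz operator when all Gaussians are integrable *)

Section ToeplitzCarleson.
Context {R : realType} (alpha : R) (alpha0 : 0 < alpha)
  (mu : {measure set (R * R) -> \bar R}).
Implicit Types (f : R[i] -> R[i]) (z h : R[i]) (w : R * R).
Context (gauss_int : forall z, mu.-integrable setT (EFin \o gauss alpha z)).

Lemma integrable_gauss_weight rho :
  mu.-integrable setT (EFin \o gauss_weight alpha rho).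
Proof.
have sum2 (f g : R * R -> R) : mu.-integrable setT (EFin \o f) ->
    mu.-integrable setT (EFin \o g) ->
    mu.-integrable setT (EFin \o (fun w => f w + g w)).
  by move=> fi gi; apply: eq_integrable (integrableD measurableT fi gi).
have := integrable_scale (expR (rho ^+ 2 / alpha)) (sum2 _ _
  (sum2 _ _ (gauss_int (rho / alpha +i* (rho / alpha))) (gauss_int (rho / alpha +i* (-
    rho / alpha))))
  (sum2 _ _ (gauss_int (- rho / alpha +i* (rho / alpha))) (gauss_int (- rho / alpha +i*
    (- rho / alpha))))).
apply: le_integrable => //.
  by apply/measurable_EFinP; exact: measurable_gauss_weight.
move=> w _ /=; rewrite lee_fin ger0_norm ?gauss_weight_ge0//.
by rewrite (le_trans (gauss_weight_le_gauss alpha0 _ _))// ler_norm.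
Qed.

Lemma toep_integrable_of_gauss f : in_Finf alpha f ->
  forall z, cintegrable mu (toep_integrand alpha mu f z).
Proof.
move=> /in_FinfP[ef [M M0 fM]] z.
apply: (cintegrable_dom _ (integrable_scale (M * expR (alpha * cnorm2 z / 2))
  (gauss_int z))).
  by apply: cmeasurable_toep; exact: (entire_measurable ef).
by move=> w; exact: cabs_toep_le.
Qed.

Lemma Toeplitz_le f (M : R) : entire f -> (fock_norm alpha f <= M%:E)%E -> 0 <= M ->
  forall z, cabs (Toeplitz alpha mu f z) * expR (- alpha * cnorm2 z / 2) <=
    2 * M * Rintegral mu setT (gauss alpha z).
Proof.
move=> ef fM M0 z.
have fin : in_Finf alpha f by apply/in_FinfP; split => //; exists M.
have := cabs_cint_le (toep_integrable_of_gauss fin z)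
  (integrable_scale (M * expR (alpha * cnorm2 z / 2)) (gauss_int z))
  (fun w => cabs_toep_le mu z w fM).
rewrite RintegralZl//.
move=> /(ler_wpM2r (expR_ge0 (- alpha * cnorm2 z / 2))) /le_trans; apply.
rewrite [leLHS](_ : _ = 2 * M * Rintegral mu setT (gauss alpha z) *
  (expR (alpha * cnorm2 z / 2) * expR (- alpha * cnorm2 z / 2))); last by ring.
rewrite -expRD [X in expR X](_ : _ = 0) ?expR0 ?mulr1//.
by move: (cnorm2 _) => A; ring.
Qed.

(** Integration of the three pointwise bounds. [C] is chosen before [f] and [M], so the estimate is
    uniform on balls, which is what [locally_quadratic] demands. *)
Lemma Toeplitz_quadratic (r : R) : exists2 C : R, 0 <= C &
  forall f (M : R), entire f -> (fock_norm alpha f <= M%:E)%E -> 0 <= M ->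
  forall z, cabs z <= r ->
  [/\ cabs (Toeplitz alpha mu f z) <= M * C,
      cabs (toep_deriv alpha mu f z) <= M * C &
      forall h, cabs h <= 1 ->
        cabs (Toeplitz alpha mu f (z + h) - Toeplitz alpha mu f z
              - h * toep_deriv alpha mu f z) <= M * C * cabs h ^+ 2].
Proof.
have [r0|r0] := leP 0 r; last first.
  by exists 0 => // f M _ _ _ z /(le_trans (cabs_ge0 z)); rewrite leNgt r0.
(* The integrals of the weights become opaque constants, known only through [WE]. *)
have [W WE] : exists W : R -> R, forall rho,
    Rintegral mu setT (gauss_weight alpha rho) = W rho by eexists.
have W0 rho : 0 <= W rho.
  by rewrite -WE; apply: Rintegral_ge0 => w _; exact: gauss_weight_ge0.
(* One summand each for the value, the derivative and the remainder. *)
pose C := 2 * W (alpha * r) + 2 * alpha * W (alpha * r + 1) +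
  8 * alpha ^+ 2 * W (alpha * (r + 1) + 2).
have a0 := ltW alpha0.
have c1 : 0 <= 2 * W (alpha * r) by rewrite mulr_ge0.
have c2 : 0 <= 2 * alpha * W (alpha * r + 1) by rewrite !mulr_ge0.
have c3 : 0 <= 8 * alpha ^+ 2 * W (alpha * (r + 1) + 2) by rewrite !mulr_ge0 ?sqr_ge0.
exists C; first by rewrite /C !addr_ge0.
move=> f M ef fM M0 z zr.
have fin : in_Finf alpha f by apply/in_FinfP; split => //; exists M.
have mf := entire_measurable ef.
have iT u := toep_integrable_of_gauss fin u.
have iW c rho := integrable_scale c (integrable_gauss_weight rho).
have iD : cintegrable mu (fun w => alpha%:C * (toC w)^* * toep_integrand alpha mu f z w).
  apply: (cintegrable_dom _ (iW (M * alpha) (alpha * r + 1))).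
    apply: cmeasurableM; last exact: cmeasurable_toep.
    by apply: cmeasurableM; [exact: cmeasurable_cst|exact: cmeasurable_conj_toC].
  by move=> w; exact: cabs_toep_deriv_le.
split.
- apply: (le_trans (cabs_cint_le (iT z) (iW M (alpha * r))
    (fun w => cabs_toep_weight alpha0 mu w fM M0 zr))).
  rewrite RintegralZl// ?WE; last exact: integrable_gauss_weight.
  by rewrite mulrCA ler_wpM2l// /C -addrA lerDl addr_ge0.
- apply: (le_trans (cabs_cint_le iD (iW (M * alpha) (alpha * r + 1))
    (fun w => cabs_toep_deriv_le alpha0 mu w fM M0 zr))).
  rewrite RintegralZl// ?WE; last exact: integrable_gauss_weight.
  rewrite [leLHS](_ : _ = M * (2 * alpha * W (alpha * r + 1))); last by ring.
  by rewrite ler_wpM2l// /C -addrA addrCA lerDl addr_ge0.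
move=> h h1.
have -> : Toeplitz alpha mu f (z + h) - Toeplitz alpha mu f z -
    h * toep_deriv alpha mu f z = cint mu (fun w => toep_integrand alpha mu f (z + h) w
     - toep_integrand alpha mu f z w
     - h * (alpha%:C * (toC w)^* * toep_integrand alpha mu f z w)).
  rewrite cintB ?cintB ?cintZ//; first exact: cintegrableB.
  exact: cintegrableZ.
apply: (le_trans (cabs_cint_le _ (iW (M * (4 * alpha ^+ 2) * cabs h ^+ 2)
  (alpha * (r + 1) + 2)) (fun w => toep_remainder_le alpha0 mu w fM M0 zr h1))).
  by apply: cintegrableB; [exact: cintegrableB|exact: cintegrableZ].
rewrite RintegralZl// ?WE; last exact: integrable_gauss_weight.
rewrite [leLHS](_ : _ = M * (8 * alpha ^+ 2 * W (alpha * (r + 1) + 2)) * cabs h ^+ 2);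
  last by ring.
by rewrite ler_wpM2r ?sqr_ge0// ler_wpM2l// /C lerDr addr_ge0.
Qed.

Lemma Toeplitz_entire f : in_Finf alpha f -> entire (Toeplitz alpha mu f).
Proof.
move=> /in_FinfP[ef [M M0 fM]] z.
have [C C0 HC] := Toeplitz_quadratic (cabs z).
have [_ _ q] := HC f M ef fM M0 z (lexx _).
exact: derivable_of_quadratic_remainder q.
Qed.

(** This yields the continuity of the Berezin transform. *)
Lemma gauss_Rintegral_lipschitz z : exists2 C : R, 0 <= C &
  forall h, cabs h <= 1 ->
  `|Rintegral mu setT (gauss alpha (z + h)) - Rintegral mu setT (gauss alpha z)| <=
  C * cabs h.
Proof.
pose r := cabs z.
exists (4 * alpha * (r + 1) * Rintegral mu setT (gauss_weight alpha (alpha * (r + 1) +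
  1))).
  rewrite !mulr_ge0 ?(ltW alpha0) ?addr_ge0 ?cabs_ge0//.
  by apply: Rintegral_ge0 => w _; exact: gauss_weight_ge0.
move=> h h1; rewrite -RintegralB//; [|exact: gauss_int|exact: gauss_int].
have iW := integrable_scale (cabs h * (4 * alpha * (r + 1)))
  (integrable_gauss_weight (alpha * (r + 1) + 1)).
have iB : mu.-integrable setT (EFin \o (fun w => gauss alpha (z + h) w - gauss alpha z
  w)).
  by apply: eq_integrable (integrableB measurableT (gauss_int (z + h)) (gauss_int z)).
apply: (le_trans (norm_Rintegral_dom iB iW _)).
  by move=> w; rewrite -mulrA; exact: gauss_lipschitz.
rewrite RintegralZl//; last exact: integrable_gauss_weight.
by rewrite -[leLHS]mulrA mulrC.
Qed.

Lemma gauss_Rintegral_locally_bounded z (r : R) : cabs z <= r ->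
  Rintegral mu setT (gauss alpha z) <= Rintegral mu setT (gauss_weight alpha (alpha * r)).
Proof.
move=> zr; apply: le_Rintegral => //.
- exact: gauss_int.
- exact: integrable_gauss_weight.
- by move=> w _; exact: gauss_le_weight.
Qed.

End ToeplitzCarleson.

(** * Compactness from decay *)

Section BoundedBerezin.
Context {R : realType} (alpha : R) (alpha0 : 0 < alpha)
  (mu : {measure set (R * R) -> \bar R}).
Implicit Types (f : R[i] -> R[i]) (z h a : R[i]) (w : R * R).

Lemma mu_tilde1_fin_num z : mu_tilde1 alpha mu z \is a fin_num <->
  mu.-integrable setT (EFin \o gauss alpha z).
Proof.
have api : 0 < alpha / pi by rewrite divr_gt0// pi_gt0.
have I0 : (0 <= \int[mu]_w (gauss alpha z w)%:E)%E.
  by apply: integral_ge0 => w _; rewrite lee_fin gauss_ge0.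
have E : mu_tilde1 alpha mu z = ((alpha / pi)%:E * \int[mu]_w (gauss alpha z w)%:E)%E
  by [].
split=> [|gi].
  rewrite E => fin; apply/integrableP; split.
    by apply/measurable_EFinP; exact: measurable_gauss.
  under eq_integral do rewrite /= ger0_norm ?gauss_ge0//.
  rewrite ltey; apply: contraL fin => /eqP ->.
  by rewrite gt0_muley// lte_fin.
rewrite E fin_numM//.
exact: integrable_fin_num gi.
Qed.

Lemma fine_mu_tilde1 z : mu.-integrable setT (EFin \o gauss alpha z) ->
  fine (mu_tilde1 alpha mu z) = alpha / pi * Rintegral mu setT (gauss alpha z).
Proof. by move=> gi; rewrite /mu_tilde1 fineM// integrable_fin_num. Qed.

(** One-sided, as it serves for non-negative functions. *)
Definition vanishing (S : R[i] -> R) :=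
  forall e : R, 0 < e -> exists r : R, forall z, r < cabs z -> S z < e.

Context (gauss_int : forall z, mu.-integrable setT (EFin \o gauss alpha z)).
Let S z : R := Rintegral mu setT (gauss alpha z).

Lemma gauss_Rintegral_ge0 z : 0 <= S z.
Proof. by apply: Rintegral_ge0 => w _; exact: gauss_ge0. Qed.

Lemma gauss_Rintegral_bounded : vanishing S ->
  exists2 B : R, 0 <= B & forall z, S z <= B.
Proof.
move=> /(_ 1 ltr01)[r rS].
pose W := Rintegral mu setT (gauss_weight alpha (alpha * r)).
have W0 : 0 <= W by apply: Rintegral_ge0 => w _; exact: gauss_weight_ge0.
exists (1 + W); first by rewrite addr_ge0.
move=> z; have [zr|/rS/ltW zS] := leP (cabs z) r.
  rewrite (le_trans (gauss_Rintegral_locally_bounded alpha0 gauss_int zr))//.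
  by rewrite lerDr.
by rewrite (le_trans zS)// lerDl.
Qed.

Lemma in_C0_gauss : vanishing S -> in_C0_ext (mu_tilde1 alpha mu).
Proof.
move=> vS; have api : 0 < alpha / pi by rewrite divr_gt0// pi_gt0.
split; first by move=> z; apply/mu_tilde1_fin_num.
split.
  move=> z; apply/(@cvgrPdist_lt _ _ _ (nbhs (z : R[i]^o))) => e e0.
  have [C C0 HC] := gauss_Rintegral_lipschitz alpha0 gauss_int z.
  have K0 : 0 < alpha / pi * C + 1 by rewrite ltr_wpDl// mulr_ge0// ltW.
  apply/nbhs_cabsP; exists (Num.min 1 (e / (alpha / pi * C + 1))).
    by rewrite lt_min ltr01 divr_gt0.
  move=> u; rewrite lt_min ltr_pdivlMr// => /andP[/ltW u1 ue].
  rewrite !fine_mu_tilde1// -mulrBr normrM gtr0_norm// distrC.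
  have := HC _ u1; rewrite [z + _]addrC subrK => /(ler_wpM2l (ltW api))/le_lt_trans;
    apply.
  apply: le_lt_trans ue; rewrite mulrA [leRHS]mulrC ler_wpM2r ?cabs_ge0//.
  by rewrite lerDl.
move=> e e0; have [r rS] := vS (e / (alpha / pi)) (divr_gt0 e0 api).
exists r => z /rS zS; rewrite fine_mu_tilde1// ger0_norm.
  by rewrite mulrC -ltr_pdivlMr.
by rewrite mulr_ge0// ?gauss_Rintegral_ge0// ltW.
Qed.

Lemma Toeplitz_compact_of_vanishing : vanishing S -> Toeplitz_compact alpha mu.
Proof.
move=> vS; have [B B0 SB] := gauss_Rintegral_bounded vS.
split; first by move=> f /(toep_integrable_of_gauss gauss_int).
split.
  move=> f ff; apply/in_FinfP; split; first exact: Toeplitz_entire.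
  have /in_FinfP[ef [M M0 fM]] := ff.
  exists (2 * M * B); first by rewrite !mulr_ge0.
  apply/fock_norm_leP => z; apply: (le_trans (Toeplitz_le gauss_int ef fM M0 z)).
  by rewrite ler_wpM2l ?mulr_ge0//; exact: SB.
move=> fs M ffs fsM.
have M0 : 0 <= M by rewrite -lee_fin (le_trans _ (fsM 0%N))// fock_norm_ge0.
have efs n : entire (fs n) by have [] := ffs n.
have [|phi [g0 [phi_incr eg0 gl]]] := @locally_quadratic_subseq R
    (fun n => Toeplitz alpha mu (fs n)) (fun n => toep_deriv alpha mu (fs n)).
  move=> r; have [C C0 HC] := Toeplitz_quadratic alpha0 gauss_int r.
  by exists (M * C) => n z zr; exact: HC.
have weight1 z : expR (- alpha * cnorm2 z / 2) <= 1.
  rewrite -expR0 ler_expR mulNr mulNr oppr_le0.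
  by rewrite divr_ge0// mulr_ge0 ?(ltW alpha0)// -sqr_cabs sqr_ge0.
have w0 z : 0 <= expR (- alpha * cnorm2 z / 2) by exact: expR_ge0.
(* The bound on [T f] passes to the limit: [k] exceeds both [|z|] and [1 / e], so [z] lies in the
   disc of radius [k] and the error is at most [e]. *)
have g0S z : cabs (g0 z) * expR (- alpha * cnorm2 z / 2) <= 2 * M * S z.
  apply/ler_addgt0Pr => e e0.
  pose k := Num.bound (cabs z + e^-1).
  have zk : cabs z + e^-1 < k%:R.
    by rewrite archi_boundP// addr_ge0 ?cabs_ge0// invr_ge0 ltW.
  have ei0 : 0 < e^-1 by rewrite invr_gt0.
  have zk1 : cabs z <= k%:R by rewrite (le_trans _ (ltW zk))// lerDl ltW.
  have ke : k.+1%:R^-1 <= e.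
    rewrite invf_ple ?posrE// -natr1 ler_wpDr// (le_trans _ (ltW zk))//.
    by rewrite lerDr cabs_ge0.
  have := gl k z zk1 => /le_trans/(_ ke) gle.
  have -> : g0 z = Toeplitz alpha mu (fs (phi k)) z - (Toeplitz alpha mu (fs (phi k)) z
    - g0 z).
    by rewrite opprB addrC subrK.
  apply: (le_trans (ler_wpM2r (w0 z) (cabsB _ _))); rewrite mulrDl lerD//.
    exact: (Toeplitz_le gauss_int (efs _) (fsM _)).
  by rewrite (le_trans _ gle)// ler_piMr ?cabs_ge0.
exists phi, g0; split => //; split.
  apply/in_FinfP; split => //; exists (2 * M * B); first by rewrite !mulr_ge0.
  apply/fock_norm_leP => z; apply: (le_trans (g0S z)).
  by rewrite ler_wpM2l ?mulr_ge0//; exact: SB.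
(* On the disc of radius [k] the choice of the subsequence suffices; outside, both terms are at most
   [2 M S z], and [S] is small there. *)
have small (e : R) : 0 < e -> \forall k \near \oo,
    (fock_norm alpha (Toeplitz alpha mu (fs (phi k)) \- g0)%R <= e%:E)%E.
  move=> e0; have M1 : 0 < 4 * M + 1 by rewrite ltr_wpDl// mulr_ge0.
  have [r rS] := vS (e / (4 * M + 1)) (divr_gt0 e0 M1).
  exists (Num.bound (`|r| + e^-1)) => // k /= kr.
  have ei0 : 0 < e^-1 by rewrite invr_gt0.
  have rk : `|r| + e^-1 < k%:R.
    apply: (@lt_le_trans _ _ (Num.bound (`|r| + e^-1))%:R); last by rewrite ler_nat.
    by rewrite archi_boundP// addr_ge0// ltW.
  have rk1 : r <= k%:R by rewrite (le_trans (ler_norm r))// (le_trans _ (ltW rk))//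
    lerDl ltW.
  have ke : k.+1%:R^-1 <= e.
    by rewrite invf_ple ?posrE// -natr1 ler_wpDr// (le_trans _ (ltW rk))// lerDr.
  apply/fock_norm_leP => z /=; have [zk|kz] := leP (cabs z) k%:R.
    apply: le_trans (le_trans (gl k z zk) ke).
    by rewrite ler_piMr ?cabs_ge0.
  apply: (le_trans (ler_wpM2r (w0 z) (cabsB _ _))); rewrite mulrDl.
  apply: (le_trans (lerD (Toeplitz_le gauss_int (efs _) (fsM _) M0 z) (g0S z))).
  have := rS z (le_lt_trans rk1 kz); rewrite -/(S z) ltr_pdivlMr//.
  move: (gauss_Rintegral_ge0 z); rewrite -/(S z).
  move: (S z) => s s0; rewrite mulrDr mulr1 => /ltW; apply: le_trans.
  by rewrite [leRHS](_ : _ = 2 * M * s + 2 * M * s + s) ?lerDl//; ring.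
apply/fine_cvgP; split.
  have := small 1 ltr01; apply: filterS => k kl.
  by rewrite ge0_fin_numE ?fock_norm_ge0// (le_lt_trans kl)// ltry.
apply/cvgrPdist_le => e e0; have := small e e0; apply: filterS => k kl /=.
have fin : fock_norm alpha (Toeplitz alpha mu (fs (phi k)) \- g0) \is a fin_num.
  by rewrite ge0_fin_numE ?fock_norm_ge0// (le_lt_trans kl)// ltry.
rewrite sub0r normrN ger0_norm ?fine_ge0 ?fock_norm_ge0//.
by rewrite -lee_fin fineK.
Qed.

End BoundedBerezin.

(** * Decay from compactness *)

Section GaussAbsorption.
Context {R : realType} (alpha : R) (alpha0 : 0 < alpha).
Implicit Types (z a : R[i]) (w : R * R).

Definition shift_sum (S : R[i] -> R) z : R :=
  S (z + 1) + S (z - 1) + (S (z + 'i) + S (z - 'i)).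

(* Far from z, moving the centre one unit towards w multiplies the Gaussian by
   at least expR 7 >= 8; near z, its square is comparable to it. *)
Lemma gauss_absorb : exists2 A : R, 0 < A & forall z w,
  gauss alpha z w <= A * gauss alpha z w ^+ 2 +
    8^-1 * shift_sum (fun u => gauss alpha u w) z.
Proof.
(* If one coordinate of the displacement is [t > rho], a unit step towards [w] raises the exponent
   by [alpha (2 t - 1) / 2], which exceeds its value 7 at [rho]. *)
pose rho : R := 2^-1 + 7 / alpha.
have rho7 : alpha * (2 * rho - 1) / 2 = 7 by rewrite /rho; field; rewrite gt_eqF.
have rho0 : 0 <= rho by rewrite addr_ge0 ?invr_ge0// divr_ge0// ltW.
exists (expR (alpha * rho ^+ 2)); first exact: expR_gt0.
move=> z w; have g0 u := gauss_ge0 alpha u w.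
have e8 : 8 <= expR 7 :> R by have := expR_ge1Dx (7 : R); lra.
have far u (s : R) : gauss alpha u w = expR s * gauss alpha z w -> 7 <= s ->
    gauss alpha z w <= 8^-1 * gauss alpha u w.
  move=> -> s7; rewrite mulrA ler_peMl//.
  by rewrite mulrC ler_pdivlMr// mul1r (le_trans e8)// ler_expR.
have sq0 : 0 <= expR (alpha * rho ^+ 2) * gauss alpha z w ^+ 2.
  by rewrite mulr_ge0 ?expR_ge0 ?sqr_ge0.
have step (t : R) : rho < t -> 7 <= alpha * (2 * t - 1) / 2.
  move=> rt; rewrite -rho7 ler_wpM2r// ler_wpM2l ?(ltW alpha0)//.
  by rewrite lerD2r ler_wpM2l// ltW.
rewrite /shift_sum; set x := complex.Re z - w.1; set y := complex.Im z - w.2.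
have [xr|xr] := ltP rho x.
  rewrite ler_wpDl// (le_trans (far (z - 1) _ _ (step _ xr)))//.
    rewrite !gaussE -expRD; congr expR; rewrite /x.
    by case: z {far g0 sq0} x y xr => a b /= _ _ _; field.
  by rewrite ler_wpM2l// -addrA addrCA lerDl !addr_ge0.
have [rx|rx] := ltP rho (- x).
  rewrite ler_wpDl// (le_trans (far (z + 1) _ _ (step _ rx)))//.
    rewrite !gaussE -expRD; congr expR; rewrite /x.
    by case: z {far g0 sq0} x y xr rx => a b /= _ _ _ _; field.
  by rewrite ler_wpM2l// -addrA lerDl !addr_ge0.
have [yr|yr] := ltP rho y.
  rewrite ler_wpDl// (le_trans (far (z - 'i) _ _ (step _ yr)))//.
    rewrite !gaussE -expRD; congr expR; rewrite /y.
    by case: z {far g0 sq0} x y xr rx yr => a b /= _ _ _ _ _; field.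
  by rewrite ler_wpM2l// addrA lerDr !addr_ge0.
have [ry|ry] := ltP rho (- y).
  rewrite ler_wpDl// (le_trans (far (z + 'i) _ _ (step _ ry)))//.
    rewrite !gaussE -expRD; congr expR; rewrite /y.
    by case: z {far g0 sq0} x y xr rx yr ry => a b /= _ _ _ _ _ _; field.
  by rewrite ler_wpM2l// addrCA lerDl !addr_ge0.
rewrite ler_wpDr ?mulr_ge0 ?invr_ge0 ?addr_ge0//.
rewrite [gauss _ _ _ ^+ 2]expr2 mulrA ler_peMl// gaussE -expRD -[leLHS]expR0 ler_expR
  -/x -/y.
have x2 : x ^+ 2 <= rho ^+ 2 by rewrite -(real_normK (num_real x)) lerXn2r ?nnegrE//
  ler_norml lerNl rx.
have y2 : y ^+ 2 <= rho ^+ 2 by rewrite -(real_normK (num_real y)) lerXn2r ?nnegrE//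
  ler_norml lerNl ry.
rewrite [leRHS](_ : _ = alpha * ((rho ^+ 2 - x ^+ 2) + (rho ^+ 2 - y ^+ 2)) / 2); last
  by field.
by rewrite divr_ge0// mulr_ge0 ?(ltW alpha0)// addr_ge0// subr_ge0.
Qed.

(** The supremum satisfies [sup <= c + (4 / 8) sup]. The bound [B] makes it finite but leaves no
    trace in the conclusion, so the result is uniform over truncations. *)
Lemma shift_sum_bounded (s : R[i] -> R) (c B : R) :
  (forall z, s z <= c + 8^-1 * shift_sum s z) -> (forall z, s z <= B) ->
  forall z, s z <= 2 * c.
Proof.
move=> sc sB z.
have hs : has_sup (range s).
  by split; [exists (s 0); exists 0|exists B => _ [u _ <-]].
have su u : s u <= sup (range s) by apply: ub_le_sup; [case: hs|exists u].
have : sup (range s) <= c + sup (range s) / 2.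
  apply: ge_sup; first by case: hs.
  move=> _ [u _ <-]; apply: (le_trans (sc u)); rewrite lerD2l /shift_sum.
  have := lerD (lerD (su (u + 1)) (su (u - 1))) (lerD (su (u + 'i)) (su (u - 'i))).
  by move=> /(ler_wpM2l (_ : 0 <= 8^-1))/le_trans; apply => //; lra.
by have := su z; lra.
Qed.

(** The upper limit L of [s] at infinity satisfies [L <= L / 2], because the contribution of [H]
    disappears. *)
Lemma shift_sum_vanishing (s H : R[i] -> R) (A B : R) : 0 < A ->
  (forall z, 0 <= s z <= B) ->
  (forall z, s z <= A * H z + 8^-1 * shift_sum s z) ->
  vanishing H -> vanishing s.
Proof.
move=> A0 sB sH vH.
(* The eventual upper bounds of [s]; [inf E] is the upper limit at infinity. *)
pose E := [set b : R | exists r : R, forall z, r < cabs z -> s z <= b].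
have E0 : lbound E 0.
  move=> b [r rb]; pose z : R[i] := (`|r| + 1)%:C.
  have /rb : r < cabs z.
    by rewrite cabs_real ger0_norm ?addr_ge0// (le_lt_trans (ler_norm r))// ltrDl.
  by apply: le_trans; have /andP[] := sB z.
have EB : E B by exists 0 => z _; have /andP[] := sB z.
have infE : has_inf E by split; [exists B|exists 0].
have half b e : E b -> 0 < e -> E (e + b / 2).
  move=> [r rb] e0; have [r' rH] := vH (e / A) (divr_gt0 e0 A0).
  (* The four shifts change the modulus by at most one, hence [r + 1]. *)
  exists (Num.max (r + 1) r') => z; rewrite gt_max => /andP[zr zr'].
  have rs u : cabs u = 1 -> s (z + u) <= b.
    move=> u1; apply: rb; have := cabsB (z + u) u.
    by rewrite addrK u1; lra.
  have one : cabs (1 : R[i]) = 1 by rewrite cabsE Normc.normc1.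
  have ii : cabs ('i : R[i]) = 1.
    by rewrite /cabs /cnorm2 /= expr0n expr1n add0r sqrtr1.
  apply: (le_trans (sH z)); apply: lerD.
    by rewrite mulrC -ler_pdivlMr// ltW// rH.
  rewrite /shift_sum.
  have := rs 1 one; have := rs (- 1) (etrans (cabsN _) one).
  have := rs 'i ii; have := rs (- 'i) (etrans (cabsN _) ii).
  by move: (s _) (s _) (s _) (s _) => p q u v; clear; lra.
have L0 : inf E <= 0.
  have Lb b : E b -> inf E <= b / 2.
    move=> Eb; apply/ler_addgt0Pr => e e0; rewrite addrC.
    by apply: ge_inf; [case: infE|exact: half].
  have : inf E * 2 <= inf E.
    apply: lb_le_inf; first by exists B.
    by move=> b /Lb; lra.
  lra.
move=> e e0; have [b [r rb] bL] := inf_adherent e0 infE.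
exists r => z /rb zb; rewrite (le_lt_trans zb)// (lt_le_trans bL)//.
by rewrite gerDr.
Qed.

End GaussAbsorption.

(** * From squares of Gaussians to Gaussians *)

Section GaussSquare.
Context {R : realType} (alpha : R) (alpha0 : 0 < alpha)
  (mu : {measure set (R * R) -> \bar R}).
Implicit Types (z a : R[i]) (w : R * R).

Lemma integrable_add d (T : measurableType d) (nu : {measure set T -> \bar R})
  (D : set T) (f g : T -> R) : measurable D -> nu.-integrable D (EFin \o f) ->
  nu.-integrable D (EFin \o g) -> nu.-integrable D (EFin \o (fun x => f x + g x)).
Proof. by move=> mD fi gi; apply: eq_integrable (integrableD mD fi gi). Qed.

Lemma measurable_gauss_sqr z : measurable_fun setT (fun w => gauss alpha z w ^+ 2).
Proof. by apply: measurable_funX; exact: measurable_gauss. Qed.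

(** The integrand of condition (M) at [z] is [expR (alpha |z|^2)] times the squared Gaussian. *)
Lemma gauss_sqr_integrable : condM alpha mu ->
  forall z, mu.-integrable setT (EFin \o (fun w => gauss alpha z w ^+ 2)).
Proof.
move=> cM z.
have E w : cnorm2 (Kern alpha z (toC w)) * expR (- alpha * cnorm2 (toC w)) =
    expR (alpha * cnorm2 z) * gauss alpha z w ^+ 2.
  rewrite -sqr_cabs /Kern cabs_cexp /gauss !expr2 -!expRD; congr expR.
  by case: z w => a b [u v]; rewrite /cnorm2 /=; field.
have : mu.-integrable setT (EFin \o (fun w => expR (alpha * cnorm2 z) * gauss alpha z w
  ^+ 2)).
  apply/integrableP; split.
    apply/measurable_EFinP; apply: measurable_funM => //; exact: measurable_gauss_sqr.
  have := cM z; under eq_integral do rewrite E.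
  apply: le_lt_trans; apply: ge0_le_integral => //=.
  - apply/measurable_EFinP; apply: measurableT_comp => //.
    by apply: measurable_funM => //; exact: measurable_gauss_sqr.
  - by apply/measurable_EFinP; apply: measurable_funM => //; exact: measurable_gauss_sqr.
  - by move=> w _; rewrite lee_fin ger0_norm// mulr_ge0 ?expR_ge0 ?sqr_ge0.
move=> /(integrable_scale (expR (- (alpha * cnorm2 z)))).
apply: eq_integrable => // w _ /=.
by rewrite mulrA -expRD addNr expR0 mul1r.
Qed.

Context (sqr_int : forall z,
  mu.-integrable setT (EFin \o (fun w => gauss alpha z w ^+ 2))).
Let H z : R := Rintegral mu setT (fun w => gauss alpha z w ^+ 2).

(** The set [D] allows truncation while the Gaussians are not yet known to be integrable on the
    plane; the squares are integrated over the whole plane, so [H] does not depend on [D]. *)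
Lemma Rintegral_gauss_absorb (A : R) (D : set (R * R)) : 0 < A -> measurable D ->
  (forall z w, gauss alpha z w <= A * gauss alpha z w ^+ 2 +
    8^-1 * shift_sum (fun u => gauss alpha u w) z) ->
  (forall z, mu.-integrable D (EFin \o gauss alpha z)) ->
  forall z, Rintegral mu D (gauss alpha z) <=
    A * H z + 8^-1 * shift_sum (fun u => Rintegral mu D (gauss alpha u)) z.
Proof.
move=> A0 mD gA gi z.
have hD : mu.-integrable D (EFin \o (fun w => gauss alpha z w ^+ 2)).
  exact: integrableS (sqr_int z).
have sc c (f : R * R -> R) : mu.-integrable D (EFin \o f) ->
    mu.-integrable D (EFin \o (fun w => c * f w)).
  by move=> fi; apply: eq_integrable (integrableZl mD c fi).
have i1 : mu.-integrable D (EFin \o (fun w => gauss alpha (z + 1) w + gauss alpha (z -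
  1) w)).
  exact: integrable_add.
have i2 : mu.-integrable D (EFin \o (fun w => gauss alpha (z + 'i) w + gauss alpha (z -
  'i) w)).
  exact: integrable_add.
have i3 : mu.-integrable D (EFin \o (fun w => shift_sum (fun u => gauss alpha u w) z)).
  exact: integrable_add.
have le1 : Rintegral mu D (gauss alpha z) <= Rintegral mu D (fun w =>
    A * gauss alpha z w ^+ 2 + 8^-1 * shift_sum (fun u => gauss alpha u w) z).
  exact: (le_Rintegral mD (gi z) (integrable_add mD (sc _ _ hD) (sc _ _ i3)) (fun w _
    => gA z w)).
apply: (le_trans le1); rewrite RintegralD ?RintegralZl//; [|exact: sc|exact: sc].
rewrite /shift_sum RintegralD// !RintegralD// lerD2r ler_wpM2l ?(ltW A0)//.
rewrite -lee_fin !fineK; [|exact: integrable_fin_num (sqr_int z)|exact: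
  integrable_fin_num hD].
apply: ge0_subset_integral => //.
  by apply/measurable_EFinP; exact: measurable_gauss_sqr.
by move=> w _; rewrite lee_fin sqr_ge0.
Qed.

(** Absorption presupposes finite integrals, so it is first applied on discs. The bound [2 A C]
    found there is independent of the disc, and monotone convergence carries it to the plane. *)
Lemma gauss_integrable_of_sqr (C : R) : (forall z, H z <= C) ->
  exists2 B : R, forall z, mu.-integrable setT (EFin \o gauss alpha z) &
    forall z, Rintegral mu setT (gauss alpha z) <= B.
Proof.
move=> HC; have [A A0 gA] := gauss_absorb alpha0.
pose D (n : nat) : set (R * R) := [set w | cnorm2 (toC w) <= n%:R].
have mD n : measurable (D n).
  have -> : D n = setT `&` (fun w => cnorm2 (0 - toC w)) @^-1` `]-oo, n%:R].
    rewrite setTI; apply/seteqP.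
    by split=> w; rewrite /D /= in_itv/= sub0r -!sqr_cabs cabsN.
  by apply: measurable_cnorm2 => //; exact: measurable_itv.
(* On [D n] the squared Gaussian centred at 0 is at least [expR (- alpha n)], while every Gaussian
   is at most 1; this gives the a priori finiteness. *)
have gD n z w : D n w -> gauss alpha z w <= expR (alpha * n%:R) * gauss alpha 0 w ^+ 2.
  move=> Dw; apply: (le_trans (gauss_le1 alpha0 z w)).
  rewrite /gauss sub0r expr2 -!expRD -[leLHS]expR0 ler_expR -sqr_cabs cabsN sqr_cabs.
  have : alpha * cnorm2 (toC w) <= alpha * n%:R by rewrite ler_wpM2l ?(ltW alpha0).
  by move: (cnorm2 _) => a; lra.
have iD n z : mu.-integrable (D n) (EFin \o gauss alpha z).
  apply: le_integrable (integrableS measurableT (mD n) (@subsetT _ _)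
    (integrable_scale (expR (alpha * n%:R)) (sqr_int 0))) => //.
    apply/measurable_EFinP; apply: measurable_funTS; exact: measurable_gauss.
  move=> w Dw /=; rewrite lee_fin ger0_norm ?gauss_ge0//.
  by rewrite (le_trans (gD _ z _ Dw))// ler_norm.
have bD n z : Rintegral mu (D n) (gauss alpha z) <= 2 * (A * C).
  apply: (@shift_sum_bounded _ (fun u => Rintegral mu (D n) (gauss alpha u)) (A * C)
    (Rintegral mu (D n) (fun w => expR (alpha * n%:R) * gauss alpha 0 w ^+ 2))).
    move=> u; apply: (le_trans (Rintegral_gauss_absorb A0 (mD n) gA (iD n) u)).
    by rewrite lerD2r ler_wpM2l// ltW.
  move=> u; apply: (le_Rintegral (mD n) (iD n u)); last by move=> w; exact: gD.
  exact: (integrableS measurableT (mD n) (@subsetT _ _)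
    (integrable_scale (expR (alpha * n%:R)) (sqr_int 0))).
have UD : \bigcup_n D n = setT.
  apply/seteqP; split => // w _; exists (Num.bound (cnorm2 (toC w))) => //=.
  by rewrite /D /= ltW// archi_boundP// -sqr_cabs sqr_ge0.
have le z : (\int[mu]_w (gauss alpha z w)%:E <= (2 * (A * C))%:E)%E.
  have nD : {homo D : m n / (m <= n)%N >-> (m <= n)%O}.
    move=> m n mn; apply/subsetPset => w; rewrite /D /= => /le_trans; apply.
    by rewrite ler_nat.
  have mg n : measurable_fun (D n) (EFin \o gauss alpha z).
    by apply/measurable_EFinP; apply: measurable_funTS; exact: measurable_gauss.
  have g0 n w : D n w -> (0 <= (EFin \o gauss alpha z) w)%E.
    by rewrite lee_fin gauss_ge0.
  have := ge0_nondecreasing_set_cvg_integral (mu := mu) nD mD mg g0.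
  rewrite UD => cv; rewrite -(cvg_lim _ cv)//.
  apply: lime_le; first exact: cvgP cv.
  apply: nearW => n; have := bD n z; rewrite -lee_fin /Rintegral fineK//.
  exact: integrable_fin_num (iD n z).
have gi z : mu.-integrable setT (EFin \o gauss alpha z).
  apply/integrableP; split; first by apply/measurable_EFinP; exact: measurable_gauss.
  under eq_integral do rewrite /= ger0_norm ?gauss_ge0//.
  by rewrite (le_lt_trans (le z))// ltry.
exists (2 * (A * C)) => // z; rewrite -lee_fin fineK; first exact: le.
exact: integrable_fin_num (gi z).
Qed.

End GaussSquare.

(** * Testing compactness on normalized kernels *)

Section NormalizedKernels.
Context {R : realType} (alpha : R) (alpha0 : 0 < alpha)
  (mu : {measure set (R * R) -> \bar R}).
Implicit Types (z a : R[i]) (w : R * R).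

Definition kern_norm a z : R[i] := Kern alpha a z * (expR (- alpha * cnorm2 a / 2))%:C.

Lemma entire_kern_norm a : entire (kern_norm a).
Proof.
move=> z; set U := alpha%:C * (a^* * z).
set E := (expR (- alpha * cnorm2 a / 2))%:C.
apply: (@derivable_of_quadratic_remainder _ _ z (alpha%:C * a^* * kern_norm a z)
  (4 * (alpha * cabs a) ^+ 2 * expR (complex.Re U + alpha * cabs a) * cabs E)) => h h1.
pose V := alpha%:C * (a^* * h).
have -> : kern_norm a (z + h) - kern_norm a z - h * (alpha%:C * a^* * kern_norm a z) =
    E * (cexp (U + V) - cexp U - V * cexp U).
  rewrite /kern_norm /Kern -/E -/U (_ : alpha%:C * (a^* * (z + h)) = U + V).
    by rewrite /V; ring.
  by rewrite /U /V; ring.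
have VE : cabs V = alpha * cabs a * cabs h.
  by rewrite /V !cabsM cabs_conj cabs_real gtr0_norm// mulrA.
rewrite cabsM mulrC [leRHS]mulrAC ler_wpM2r ?cabs_ge0//.
apply: (le_trans (cexp_taylor_le _ _)); rewrite VE exprMn mulrA [leRHS]mulrAC.
rewrite ler_wpM2l//; first by rewrite mulr_ge0 ?sqr_ge0// mulr_ge0 ?sqr_ge0.
rewrite ler_expR lerD2l.
by rewrite ler_piMr// mulr_ge0 ?cabs_ge0 ?(ltW alpha0).
Qed.

Lemma cabs_kern_norm a w :
  cabs (kern_norm a (toC w)) = gauss alpha a w * expR (alpha * cnorm2 (toC w) / 2).
Proof.
rewrite cabsM cabs_cexp cabs_real ger0_norm ?expR_ge0// /gauss -!expRD; congr expR.
by case: a w => a b [u v]; rewrite /cnorm2 /=; field.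
Qed.

Lemma fock_norm_kern_norm a : (fock_norm alpha (kern_norm a) <= 1%:E)%E.
Proof.
apply/fock_norm_leP => -[x y]; rewrite (cabs_kern_norm a (x, y)) -mulrA -expRD.
rewrite [X in expR X](_ : _ = 0) ?expR0 ?mulr1; first exact: gauss_le1.
by move: (cnorm2 _) => c; ring.
Qed.

Lemma in_Finf_kern_norm a : in_Finf alpha (kern_norm a).
Proof.
apply/in_FinfP; split; first exact: entire_kern_norm.
by exists 1 => //; exact: fock_norm_kern_norm.
Qed.

(** At [z = a] the two kernel factors are conjugate to each other, so the integrand is a
    non-negative real number and the integral has no cancellation. *)
Lemma toep_kern_norm_diag a w : toep_integrand alpha mu (kern_norm a) a w =
  (expR (alpha * cnorm2 a / 2) * gauss alpha a w ^+ 2)%:C.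
Proof.
rewrite toep_integrandE /kern_norm /Kern.
set U := alpha%:C * (a^* * toC w); set V := alpha%:C * (a * (toC w)^*).
rewrite [LHS](_ : _ = cexp (U + V) * ((expR (- alpha * cnorm2 a / 2))%:C *
  (expR (- alpha * cnorm2 (toC w)))%:C)); last by rewrite cexpD; ring.
have -> : U + V = (2 * alpha * (complex.Re a * w.1 + complex.Im a * w.2))%:C.
  rewrite /U /V; case: a w {U V} => a b [u v]; apply/eqP; rewrite eq_complex /=.
  by apply/andP; split; apply/eqP; ring.
have cexp_real (x : R) : cexp x%:C = (expR x)%:C.
  by rewrite /cexp /= cos0 sin0 mulr1 mulr0.
rewrite cexp_real -!rmorphM/=; congr (_%:C).
rewrite /gauss [expR _ ^+ 2]expr2 -!expRD; congr expR.
by case: a w {U V} => a b [u v]; rewrite /cnorm2 /=; field.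
Qed.

(* The parallelogram law with the midpoint of [a] and [z]. *)
Lemma gauss_mul a z w : gauss alpha a w * gauss alpha z w =
  expR (- alpha * cnorm2 (a - z) / 4) * gauss alpha ((a + z) / 2) w ^+ 2.
Proof.
rewrite [gauss _ _ _ ^+ 2]expr2 !gaussE -!expRD; congr expR.
have -> : (a + z) / 2 = ((complex.Re a + complex.Re z) / 2) +i*
    ((complex.Im a + complex.Im z) / 2).
  have -> : (2 : R[i])^-1 = (2^-1)%:C by rewrite -[2]/(2%:R) -(rmorph_nat (real_complex
    R)) -fmorphV.
  by case: a z => a b [c d]; apply/eqP; rewrite eq_complex /=;
    apply/andP; split; apply/eqP; ring.
by case: a z w => a b [c d] [u v]; rewrite /cnorm2 /=; field.
Qed.

Lemma cabs_toep_kern_norm a z w : cabs (toep_integrand alpha mu (kern_norm a) z w) =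
  expR (alpha * cnorm2 z / 2) * (gauss alpha a w * gauss alpha z w).
Proof.
rewrite toep_integrandE [cabs (_ * _ * _)]cabsM [cabs (kern_norm a _ * _)]cabsM.
rewrite cabs_kern_norm cabs_cexp cabs_real ger0_norm ?expR_ge0//.
rewrite /gauss -!expRD; congr expR.
by case: a z w => a b [c d] [u v]; rewrite /cnorm2 /=; field.
Qed.

Context (sqr_int : forall z,
  mu.-integrable setT (EFin \o (fun w => gauss alpha z w ^+ 2))).
Let H z : R := Rintegral mu setT (fun w => gauss alpha z w ^+ 2).

(** The real part of [T k_a(a)] is exactly [expR (alpha |a|^2 / 2) * H a]. *)
Lemma gauss_sqr_le_Toeplitz a :
  H a <= cabs (Toeplitz alpha mu (kern_norm a) a) * expR (- alpha * cnorm2 a / 2).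
Proof.
rewrite -ler_pdivrMr ?expR_gt0// -expRN.
apply: le_trans (Re_le_cabs _); apply: le_trans (ler_norm _).
have -> : complex.Re (Toeplitz alpha mu (kern_norm a) a) =
    Rintegral mu setT (fun w => expR (alpha * cnorm2 a / 2) * gauss alpha a w ^+ 2).
  by apply: eq_Rintegral => w _; rewrite toep_kern_norm_diag.
rewrite RintegralZl// mulrC ler_wpM2r//.
  by apply: Rintegral_ge0 => w _; exact: sqr_ge0.
by rewrite ler_expR; move: (cnorm2 _) => c; lra.
Qed.

Lemma Toeplitz_kern_norm_le a z : cintegrable mu (toep_integrand alpha mu (kern_norm a)
  z) ->
  cabs (Toeplitz alpha mu (kern_norm a) z) <=
  2 * expR (alpha * cnorm2 z / 2) * expR (- alpha * cnorm2 (a - z) / 4) * H ((a + z) / 2).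
Proof.
move=> iT; apply: (le_trans (cabs_cint_le iT (integrable_scale
  (expR (alpha * cnorm2 z / 2) * expR (- alpha * cnorm2 (a - z) / 4))
  (sqr_int ((a + z) / 2))) _)).
  by move=> w; rewrite cabs_toep_kern_norm gauss_mul mulrA.
by rewrite RintegralZl// !mulrA.
Qed.

Lemma Toeplitz_kern_norm_small z (B d : R) : 0 < d -> (forall a, H a <= B) ->
  (forall a, cintegrable mu (toep_integrand alpha mu (kern_norm a) z)) ->
  exists r : R, forall a, r < cabs a -> cabs (Toeplitz alpha mu (kern_norm a) z) <= d.
Proof.
move=> d0 HB iT.
have B0 : 0 <= B.
  by apply: le_trans (HB 0); apply: Rintegral_ge0 => w _; exact: sqr_ge0.
pose K := 2 * expR (alpha * cnorm2 z / 2) * B.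
have K0 : 0 <= K by rewrite !mulr_ge0 ?expR_ge0.
(* Solves [K / d = alpha q / 4]. The extra 1 in the radius gives [|a - z| >= 1], so that
   [|a - z|^2 >= |a - z| >= q]. *)
pose q := K / d * 4 / alpha.
have q0 : 0 <= q.
  apply: divr_ge0 (ltW alpha0); apply: mulr_ge0 => //.
  by apply: divr_ge0 => //; exact: ltW.
exists (cabs z + 1 + q) => a ar.
have s1 : 1 + q <= cabs (a - z).
  have := cabsD (a - z) z; rewrite subrK => h.
  by rewrite -(lerD2r (cabs z)) (le_trans _ h)// addrC addrA ltW.
have s2 : q <= cnorm2 (a - z).
  rewrite -sqr_cabs; move: s1; move: (cabs _) => s s1.
  by rewrite (@le_trans _ _ (1 + q))// ?lerDr// (le_trans s1)// expr2 ler_peMl//; lra.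
have t : K / d <= expR (alpha * cnorm2 (a - z) / 4).
  apply: (@le_trans _ _ (1 + alpha * cnorm2 (a - z) / 4)); last exact: expR_ge1Dx.
  have -> : K / d = alpha * q / 4 by rewrite /q; field; rewrite !gt_eqF.
  rewrite ler_wpDl// ler_wpM2r// ler_wpM2l// ltW//.
apply: (le_trans (Toeplitz_kern_norm_le (iT a))).
rewrite mulrAC (@le_trans _ _ (K * expR (- alpha * cnorm2 (a - z) / 4)))//.
  by rewrite ler_wpM2r ?expR_ge0// ler_wpM2l// mulr_ge0 ?expR_ge0.
rewrite !mulNr expRN ler_pdivrMr ?expR_gt0// mulrC.
by move: t; rewrite ler_pdivrMr.
Qed.

Context (cT : Toeplitz_compact alpha mu).

(** Compactness is applied to kernels, all of norm at most 1, and convergence in norm is unfolded to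
    a bound uniform in [z]; it can then be evaluated at the moving point [a (phi k)]. *)
Lemma kern_norm_subseq (a : nat -> R[i]) : exists (phi : nat -> nat) (g : R[i] -> R[i]),
  [/\ {homo phi : m n / (m < n)%N}, in_Finf alpha g & forall e : R, 0 < e ->
    \forall k \near \oo, forall z,
      cabs (Toeplitz alpha mu (kern_norm (a (phi k))) z - g z) * expR (- alpha * cnorm2
        z / 2) <= e].
Proof.
have [_ [_ seq_cpt]] := cT.
have [|n|phi [g [phi_incr [fg cvg0]]]] := seq_cpt (fun n => kern_norm (a n)) 1.
- by move=> n; exact: in_Finf_kern_norm.
- exact: fock_norm_kern_norm.
exists phi, g; split => // e e0.
have /fine_cvgP[finN /cvgrPdist_le/(_ e e0)] := cvg0.
apply: filterS2 finN => k fin; rewrite /= sub0r normrN => ke.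
apply/fock_norm_leP; rewrite -(fineK fin) lee_fin.
exact: le_trans (ler_norm _) ke.
Qed.

Lemma homo_geq_id (phi : nat -> nat) : {homo phi : m n / (m < n)%N} ->
  forall n, (n <= phi n)%N.
Proof.
move=> phi_incr; elim=> // n IH; exact: leq_ltn_trans IH (phi_incr _ _ (ltnSn n)).
Qed.

(** If [H (a n) > n], evaluating the norm convergence at [a (phi k)] gives [H (a (phi k)) <= 1 + M],
    with [M] a bound for the norm of the limit. *)
Lemma gauss_sqr_bounded : exists B : R, forall a, H a <= B.
Proof.
apply: contrapT => /forallNP unb.
have /choice[a aP] (n : nat) : exists a, n%:R < H a.
  apply: contrapT => /forallNP nH; apply: (unb n%:R) => b.
  by rewrite leNgt; apply/negP; exact: nH.
have [phi [g [phi_incr /in_FinfP[_ [M M0 /fock_norm_leP gM]] gl]]] := kern_norm_subseq a.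
have [N _ /= NP] := gl 1 ltr01.
(* As [phi k >= k], this makes [H (a (phi k)) > phi k] exceed [1 + M]. *)
pose k := maxn N (Num.bound (1 + M)).
have := NP k (leq_maxl _ _) (a (phi k)); set z := a (phi k) => zk.
have := gauss_sqr_le_Toeplitz z.
have -> : Toeplitz alpha mu (kern_norm z) z =
  (Toeplitz alpha mu (kern_norm z) z - g z) + g z by rewrite subrK.
move=> /le_trans/(_ (ler_wpM2r (expR_ge0 _) (cabsD _ _))).
rewrite mulrDl => /le_trans/(_ (lerD zk (gM z))).
rewrite leNgt => /negP; apply.
apply: lt_trans (aP (phi k)).
apply: (@lt_le_trans _ _ (Num.bound (1 + M))%:R).
  by rewrite archi_boundP// addr_ge0.
by rewrite ler_nat (leq_trans (leq_maxr N _))// homo_geq_id.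
Qed.

(** Along centres going to infinity with [H >= e], the norm limit is also the pointwise limit, which
    is 0; evaluation at the centres then contradicts [H >= e]. *)
Lemma gauss_sqr_vanishing : vanishing H.
Proof.
have [B HB] := gauss_sqr_bounded.
have iT a z : cintegrable mu (toep_integrand alpha mu (kern_norm a) z).
  by have [+ _] := cT; apply; exact: in_Finf_kern_norm.
move=> e e0; apply: contrapT => /forallNP nv.
have /choice[a aP] (n : nat) : exists a, n%:R < cabs a /\ e <= H a.
  apply: contrapT => /forallNP na; apply: (nv n%:R) => z nz.
  by rewrite ltNge; apply/negP => ez; exact: (na z).
have [phi [g [phi_incr _ gl]]] := kern_norm_subseq a.
have w0 z : 0 <= expR (- alpha * cnorm2 z / 2) by exact: expR_ge0.
(* At a fixed [z], half of [d] pays for the distance to [g], half for [T k_a(z)] with [a] far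
   away. *)
have g0 z : cabs (g z) * expR (- alpha * cnorm2 z / 2) <= 0.
  apply/ler_addgt0Pr => d d0; rewrite add0r.
  have d20 : 0 < d / 2 by rewrite divr_gt0.
  have [r rT] := Toeplitz_kern_norm_small d20 HB (iT^~ z).
  have [N _ /= NP] := gl (d / 2) d20.
  pose k := maxn N (Num.bound `|r|).
  have zk := NP k (leq_maxl _ _) z.
  have ar : r < cabs (a (phi k)).
    have [+ _] := aP (phi k); apply: le_lt_trans.
    rewrite (le_trans (ler_norm r))// ltW//.
    apply: (@lt_le_trans _ _ (Num.bound `|r|)%:R); first by rewrite archi_boundP.
    by rewrite ler_nat (leq_trans (leq_maxr N _))// homo_geq_id.
  have := rT _ ar; set T := Toeplitz _ _ _ _ in zk * => Td.
  have -> : g z = T - (T - g z) by rewrite opprB addrC subrK.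
  apply: (le_trans (ler_wpM2r (w0 z) (cabsB _ _))); rewrite mulrDl (splitr d).
  apply: lerD => //; rewrite (le_trans _ Td)// ler_piMr ?cabs_ge0//.
  rewrite -expR0 ler_expR !mulNr oppr_le0.
  by rewrite divr_ge0// mulr_ge0 ?(ltW alpha0)// -sqr_cabs sqr_ge0.
have e20 : 0 < e / 2 by rewrite divr_gt0.
have [N _ /= NP] := gl (e / 2) e20.
have := NP N (leqnn N) (a (phi N)).
have [_] := aP (phi N); set z := a (phi N) => ez zk.
have := gauss_sqr_le_Toeplitz z.
have -> : Toeplitz alpha mu (kern_norm z) z =
  (Toeplitz alpha mu (kern_norm z) z - g z) + g z by rewrite subrK.
move=> /le_trans/(_ (ler_wpM2r (expR_ge0 _) (cabsD _ _))).
rewrite mulrDl => /le_trans/(_ (lerD zk (g0 z))) /(le_trans ez).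
rewrite addr0 leNgt => /negP; apply.
by rewrite ltr_pdivrMr// mulr_natr mulr2n ltrDl.
Qed.

End NormalizedKernels.

Theorem theorem4p2 (R : realType) (alpha : R)
  (mu : {measure set (R * R)%type -> \bar R}) :
  0 < alpha -> condM alpha mu ->
  (Toeplitz_compact alpha mu <-> in_C0_ext (mu_tilde1 alpha mu)).
Proof.
move=> alpha0 cM; split=> [cT|[fin [_ v]]].
  have sqr_int := gauss_sqr_integrable cM.
  (* Compactness bounds [H], and only this bound makes the Gaussians integrable and [mu_tilde1]
     finite; decay is transferred afterwards. *)
  have [C HC] := gauss_sqr_bounded alpha0 sqr_int cT.
  have [B gi gB] := gauss_integrable_of_sqr alpha0 sqr_int HC.
  have [A A0 gA] := gauss_absorb alpha0.
  apply: in_C0_gauss => //; apply: (shift_sum_vanishing (B := B) (H := fun z =>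
    Rintegral mu setT (fun w => gauss alpha z w ^+ 2)) A0).
  - by move=> z; rewrite gB andbT; exact: gauss_Rintegral_ge0.
  - by move=> z; exact: (Rintegral_gauss_absorb sqr_int A0 measurableT gA gi).
  - exact: gauss_sqr_vanishing.
(* Conversely, finiteness of [mu_tilde1] is the integrability of the Gaussians. *)
have gi z : mu.-integrable setT (EFin \o gauss alpha z) by apply/mu_tilde1_fin_num.
apply: Toeplitz_compact_of_vanishing => // e e0.
have api : 0 < alpha / pi by rewrite divr_gt0// pi_gt0.
have [r rv] := v (alpha / pi * e) (mulr_gt0 api e0).
exists r => z /rv; rewrite fine_mu_tilde1// => /(le_lt_trans (ler_norm _)).
by rewrite ltr_pM2l.
Qed.
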